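(* Let $G$ be a finite group and let $P$ be a collection of primes. Let $L \leq G$ be a $P$-perfect subgroup and let $e_L \in A(G)_{(P)}$ be the corresponding primitive idempotent. Then the following hold: (i) The admissible sets for $e_L$ assemble into an indexing system $\mathcal{I}_L$ such that $A(-)_{(P)}[e_L^{-1}]$ is an $\mathcal{I}_L$-Tambara functor under $A(-)_{(P)}$. (ii) In the poset of indexing systems, $\mathcal{I}_L$ is maximal among the elements that satisfy (i), i.e. among the indexing systems $\mathcal{J}$ such that $A(-)_{(P)}[e_L^{-1}]$ is a $\mathcal{J}$-Tambara functor under $A(-)_{(P)}$. (iii) The map $A(-)_{(P)} \to A(-)_{(P)}[e_L^{-1}]$ is the localization of $A(-)_{(P)}$ at $e_L$ in the category of $\mathcal{I}_L$-Tambara functors.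
   Context: $\mathbb{Z}_{(P)}=\mathbb{Z}[p^{-1}\mid p\notin P]$; for $H\leq G$, $A(H)$ is the Burnside ring of finite $H$-sets and $A(H)_{(P)}=A(H)\otimes\mathbb{Z}_{(P)}$. $A(-)_{(P)}$ is a Tambara functor with restrictions $R^H_K$, transfers $T_K^H$ and norms $N_K^H$ extending restriction, induction and co-induction $X\mapsto\mathrm{Map}_K(H,X)$ of finite sets. For $Q\leq G$ the mark $\phi^Q\colon A(G)_{(P)}\to\mathbb{Z}_{(P)}$ is the ring homomorphism with $\phi^Q([S])=|S^Q|$. For a finite group $Q$, $O^P(Q)$ is the unique minimal normal subgroup such that $Q/O^P(Q)$ is a solvable group whose order is divisible only by primes in $P$; $Q$ is $P$-perfect if $Q=O^P(Q)$. By Dress, conjugacy classes of $P$-perfect subgroups $L\le G$ correspond bijectively to primitive idempotents $e_L\in A(G)_{(P)}$, where $\phi^Q(e_L)=1$ if $O^P(Q)$ is conjugate in $G$ to $L$, and $0$ otherwise. $A(-)_{(P)}[e_L^{-1}]$ is the levelwise localization, with value $A(H)_{(P)}[R^G_H(e_L)^{-1}]$ at $H\leq G$; it is a Green ring (Mackey functor with commutative ring values, restrictions ring maps, transfers module maps over the target). Admissible sets for $e_L$: for $K\le H\le G$, the $H$-set $H/K$ is admissible for $e_L$ if ($\star$) every $L'\leq H$ that is conjugate in $G$ to $L$ is contained in $K$. A finite $H$-set is admissible if all of its orbits are. Indexing system: a contravariant functor $\mathcal{I}$ from the orbit category of $G$ to symmetric monoidal categories and strong symmetric monoidal functors, $G/H\mapsto\mathcal{I}(H)$,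 which is a subfunctor of $G/H\mapsto \mathcal{S}et^H$ (finite $H$-sets under disjoint union, with restriction and conjugation functors), such that (1) $\mathcal{I}(H)$ is a full symmetric monoidal subcategory of $\mathcal{S}et^H$ containing all trivial $H$-sets; (2) each $\mathcal{I}(H)$ is closed under finite limits; (3) if $H/K\in\mathcal{I}(H)$ and $T\in\mathcal{I}(K)$ then $H\times_K T\in\mathcal{I}(H)$. Indexing systems form a poset under inclusion. Incomplete Tambara functors: the category of bispans has as objects finite $G$-sets and as morphisms isomorphism classes of diagrams $X\leftarrow Y\to Z\to W$ of finite $G$-sets (encoding a restriction, then a norm, then a transfer), with the usual composition used to define Tambara functors. For an indexing system $\mathcal{I}$, the bispans whose middle map $f\colon Y\to Z$ satisfies $G_{f(y)}/G_y\in\mathcal{I}(G_{f(y)})$ for all $y\in Y$ (with $G_y$ the stabilizer) form a subcategory. An $\mathcal{I}$-Tambara functor is a product-preserving functor from this subcategory to sets whose values are abelian groups under the addition induced by transfers along fold maps; morphisms are natural transformations. A Tambara functor is an $\mathcal{I}$-Tambara functor for every $\mathcal{I}$ by forgetting norms. ''$A(-)_{(P)}[e_L^{-1}]$ is a $\mathcal{J}$-Tambara functor under $A(-)_{(P)}$'' means that this Green ring has a $\mathcal{J}$-Tambara functor structure for which the canonical map $A(-)_{(P)}\to A(-)_{(P)}[e_L^{-1}]$ is a map of $\mathcal{J}$-Tambara functors (so its norms are inherited from $A(-)_{(P)}$). ''Localization at $e_L$ in the category of $\mathcal{I}_L$-Tambara functors'' means that the map is initial among maps of $\mathcal{I}_L$-Tambara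 functors $A(-)_{(P)}\to \underline{R}$ for which the image of $e_L$ in $\underline{R}(G)$ is a unit. *)

(* Defs.v *)
From HB Require Import structures.
From mathcomp Require Import all_boot all_order all_fingroup all_solvable all_algebra.

Set Implicit Arguments.
Unset Strict Implicit.
Unset Printing Implicit Defensive.

Import GroupScope.

(* MathComp actions are right actions, so an [hset H] is a finite right H-set
   and the orbit "H/K" is the set of right cosets of K in H; inversion in the
   group identifies this with the category of finite left H-sets. *)

Record hset (gT : finGroupType) (H : {group gT}) := HSet {
  hcar :> finType;
  hact : action H hcar }.
Arguments hact {gT H} h.

Record hmap (gT : finGroupType) (H : {group gT}) (S T : hset H) := HMap {
  hfun :> S -> T;
  hmapP : forall x, {in H, forall a, hfun (hact S x a) = hact T (hfun x) a} }.

Definition hiso (gT : finGroupType) (H : {group gT}) (S T : hset H) : Prop :=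
  exists f : hmap S T, bijective f.

(* [action H T] asks that every a : gT acts injectively, even for a \notin H;
   an operation given on H only is completed by the identity outside H. *)
Section MkHSet.
Variables (gT : finGroupType) (H : {group gT}) (T : finType) (to : T -> gT -> T).
Hypothesis to1 : forall x, to x 1 = x.
Hypothesis toM : {in H &, forall a b x, to x (a * b) = to (to x a) b}.

Definition ext_act x a := if a \in H then to x a else x.

Lemma ext_act_is_action : is_action H ext_act.
Proof.
split=> [a x y|x a b aH bH]; last by rewrite /ext_act groupM // aH bH toM.
rewrite /ext_act; case: ifP => // aH /(congr1 (to^~ a^-1)).
by rewrite -!toM ?groupV // mulgV !to1.
Qed.

Definition mk_hset : hset H := HSet (Action ext_act_is_action).

Lemma mk_hsetE x a : a \in H -> hact mk_hset x a = to x a.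
Proof. by move=> aH; rewrite /= /ext_act aH. Qed.
End MkHSet.

Lemma hact1 (gT : finGroupType) (H : {group gT}) (S : hset H) (x : S) :
  hact S x 1 = x.
Proof. exact: act1. Qed.

Lemma hactM (gT : finGroupType) (H : {group gT}) (S : hset H) :
  {in H &, forall a b (x : S), hact S x (a * b) = hact S (hact S x a) b}.
Proof. by move=> a b aH bH x; rewrite actMin. Qed.

Section Constructions.
Variables (gT : finGroupType).
Implicit Types H K : {group gT}.

Definition htriv_op (T : finType) (x : T) (a : gT) : T := x.
Lemma htriv_op1 (T : finType) x : @htriv_op T x 1 = x. Proof. by []. Qed.
Lemma htriv_opM H (T : finType) :
  {in H &, forall a b x, @htriv_op T x (a * b) = htriv_op (htriv_op x a) b}.
Proof. by []. Qed.
Definition htriv H (T : finType) : hset H :=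
  mk_hset (@htriv_op1 T) (@htriv_opM H T).

Definition hsum_op H (S T : hset H) (u : S + T) (a : gT) : S + T :=
  match u with inl x => inl (hact S x a) | inr y => inr (hact T y a) end.
Lemma hsum_op1 H (S T : hset H) u : @hsum_op H S T u 1 = u.
Proof. by case: u => x /=; rewrite hact1. Qed.
Lemma hsum_opM H (S T : hset H) :
  {in H &, forall a b u, @hsum_op H S T u (a * b) = hsum_op (hsum_op u a) b}.
Proof. by move=> a b aH bH [] x /=; rewrite hactM. Qed.
Definition hsum H (S T : hset H) : hset H :=
  mk_hset (@hsum_op1 H S T) (@hsum_opM H S T).

Definition hprod_op H (S T : hset H) (u : S * T) (a : gT) : S * T :=
  (hact S u.1 a, hact T u.2 a).
Lemma hprod_op1 H (S T : hset H) u : @hprod_op H S T u 1 = u.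
Proof. by case: u => x y; rewrite /hprod_op /= !hact1. Qed.
Lemma hprod_opM H (S T : hset H) :
  {in H &, forall a b u, @hprod_op H S T u (a * b) = hprod_op (hprod_op u a) b}.
Proof. by move=> a b aH bH [x y]; rewrite /hprod_op /= !hactM. Qed.
Definition hprod H (S T : hset H) : hset H :=
  mk_hset (@hprod_op1 H S T) (@hprod_opM H S T).

(* Partial functions from S to T, with the conjugation action. *)
Definition hpfun_op H (S T : hset H) (s : {ffun S -> option T}) (a : gT) :
    {ffun S -> option T} :=
  [ffun x => omap (fun y => hact T y a) (s (hact S x a^-1))].
Lemma hpfun_op1 H (S T : hset H) s : @hpfun_op H S T s 1 = s.
Proof.
apply/ffunP=> x; rewrite ffunE invg1 hact1.
by case: (s x) => //= y; rewrite hact1.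
Qed.
Lemma hpfun_opM H (S T : hset H) :
  {in H &, forall a b s, @hpfun_op H S T s (a * b) = hpfun_op (hpfun_op s a) b}.
Proof.
move=> a b aH bH s; apply/ffunP=> x; rewrite !ffunE invMg.
by rewrite hactM ?groupV //; case: (s _) => //= y; rewrite hactM.
Qed.
Definition hpfun H (S T : hset H) : hset H :=
  mk_hset (@hpfun_op1 H S T) (@hpfun_opM H S T).

Section Sub.
Variables (H : {group gT}) (S : hset H) (p : pred S).
Hypothesis pH : {in H, forall a x, p x -> p (hact S x a)}.
Definition hsub_op (u : {x | p x}) (a : gT) : {x | p x} :=
  insubd u (hact S (val u) a).
Lemma hsub_opE u a : a \in H -> val (hsub_op u a) = hact S (val u) a.
Proof. by move=> aH; rewrite val_insubd pH // (valP u). Qed.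
Lemma hsub_op1 u : hsub_op u 1 = u.
Proof. by apply: val_inj; rewrite hsub_opE // hact1. Qed.
Lemma hsub_opM :
  {in H &, forall a b u, hsub_op u (a * b) = hsub_op (hsub_op u a) b}.
Proof.
by move=> a b aH bH u; apply: val_inj; rewrite !hsub_opE ?groupM // hactM.
Qed.
Definition hsub : hset H := mk_hset hsub_op1 hsub_opM.
Lemma hsubE (u : hsub) a : a \in H -> val (hact hsub u a) = hact S (val u) a.
Proof. by move=> aH; rewrite mk_hsetE // hsub_opE. Qed.
End Sub.

(* H/K: the right cosets of K in H under right translation. *)
Definition trans_op (C : {set gT}) (a : gT) : {set gT} := C :* a.
Lemma trans_op1 C : trans_op C 1 = C. Proof. exact: mulg1. Qed.
Lemma trans_opM H :
  {in H &, forall a b C, trans_op C (a * b) = trans_op (trans_op C a) b}.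
Proof. by move=> a b _ _ C; rewrite /trans_op rcosetM. Qed.
Definition htrans H : hset H := mk_hset trans_op1 (@trans_opM H).

Lemma hquo_stable H K :
  {in H, forall a (C : htrans H), C \in rcosets K H ->
                                  hact (htrans H) C a \in rcosets K H}.
Proof.
move=> a aH C /rcosetsP[h hH ->]; rewrite mk_hsetE // /trans_op -rcosetM.
by apply/rcosetsP; exists (h * a); rewrite ?groupM.
Qed.
Definition hquo H K : hset H := hsub (@hquo_stable H K).

(* H x_K T: the quotient of T x H by (t k, h) ~ (t, k h) for k in K; an element
   is an equivalence class, as a subset of T x gT. *)
Definition ind_class K (T : hset K) (t : T) (h : gT) : {set T * gT} :=
  [set (hact T t k, k^-1 * h) | k in K].
Definition ind_op K (T : hset K) (C : {set T * gT}) (a : gT) : {set T * gT} :=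
  [set (u.1, u.2 * a) | u in C].
Lemma ind_op1 K (T : hset K) C : @ind_op K T C 1 = C.
Proof.
rewrite /ind_op -[RHS]imset_id; apply: eq_imset => -[t h] /=.
by rewrite mulg1.
Qed.
Lemma ind_opM H K (T : hset K) :
  {in H &, forall a b C, @ind_op K T C (a * b) = ind_op (ind_op C a) b}.
Proof.
move=> a b _ _ C; rewrite /ind_op -imset_comp.
by apply: eq_imset => -[t h] /=; rewrite mulgA.
Qed.
Definition hind_amb H K (T : hset K) : hset H :=
  mk_hset (@ind_op1 K T) (@ind_opM H K T).
Lemma ind_op_class K (T : hset K) t h a :
  ind_op (@ind_class K T t h) a = ind_class t (h * a).
Proof.
rewrite /ind_op /ind_class -imset_comp.
by apply: eq_imset => k /=; rewrite mulgA.
Qed.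
Lemma hind_stable H K (T : hset K) :
  {in H, forall a (C : hind_amb H T),
     [exists t, exists h in H, C == ind_class t h] ->
     [exists t, exists h in H, hact (hind_amb H T) C a == ind_class t h]}.
Proof.
move=> a aH C /existsP[t /exists_inP[h hH /eqP->]].
apply/existsP; exists t; apply/exists_inP; exists (h * a); rewrite ?groupM //.
by rewrite mk_hsetE // ind_op_class.
Qed.
Definition hind H K (T : hset K) : hset H := hsub (@hind_stable H K T).

Lemma hind_proj_subproof H K (T : hset K) (C : hind H T) :
  [set u.2 | u in val C] \in rcosets K H.
Proof.
case: C => C /= /existsP[t /exists_inP[h hH /eqP->]].
apply/rcosetsP; exists h => //; apply/setP=> x.
apply/imsetP/rcosetP => [[_ /imsetP[k kK ->] ->] | [k kK ->]] /=.
  by exists k^-1; rewrite ?groupV.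
exists (hact T t k^-1, k^-1^-1 * h) => /=; last by rewrite invgK.
by apply/imsetP; exists k^-1; rewrite ?groupV.
Qed.
Definition hind_proj_fun H K (T : hset K) (C : hind H T) : hquo H K :=
  exist (fun D : htrans H => D \in rcosets K H) _ (hind_proj_subproof C).
Lemma hind_projP H K (T : hset K) (C : hind H T) :
  {in H, forall a, hind_proj_fun (hact (hind H T) C a)
                   = hact (hquo H K) (hind_proj_fun C) a}.
Proof.
move=> a aH; apply: val_inj; rewrite [RHS]hsubE // [RHS]mk_hsetE //.
change ([set u.2 | u in val (hact (hind H T) C a)] = [set u.2 | u in val C] :* a).
rewrite hsubE // mk_hsetE // /ind_op -imset_comp.
apply/setP=> x; apply/imsetP/rcosetP => [[u uC ->]|[_ /imsetP[u uC ->] ->]].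
  by exists u.2 => //; apply: imset_f.
by exists u.
Qed.
Definition hind_proj H K (T : hset K) : hmap (hind H T) (hquo H K) :=
  HMap (@hind_projP H K T).

(* The restriction of an H-set along the map K -> H, k |-> g k g^-1; these
   functors are the images of the maps G/K -> G/H, K x |-> H g x. *)
Section Pull.
Variables (H K : {group gT}) (g : gT).
Hypothesis sKH : K \subset H :^ g.
Variable S : hset H.
Definition hpull_op (x : S) (k : gT) : S := hact S x (k ^ g^-1).
Lemma hpull_op1 x : hpull_op x 1 = x.
Proof. by rewrite /hpull_op conj1g hact1. Qed.
Lemma hpull_opM :
  {in K &, forall a b x, hpull_op x (a * b) = hpull_op (hpull_op x a) b}.
Proof.
move=> a b aK bK x; rewrite /hpull_op conjMg hactM // -mem_conjg.
  exact: (subsetP sKH).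
exact: (subsetP sKH).
Qed.
Definition hpull : hset K := mk_hset hpull_op1 hpull_opM.
End Pull.

End Constructions.

(* The shape is a finite directed graph; the cones over a diagram indexed by a
   finite category are those over its underlying graph diagram. *)
Record diagram (gT : finGroupType) (H : {group gT}) := Diagram {
  dvert : finType;
  dedge : finType;
  dsrc : dedge -> dvert;
  dtgt : dedge -> dvert;
  dob :> dvert -> hset H;
  darr : forall j, hmap (dob (dsrc j)) (dob (dtgt j)) }.

Definition is_cone (gT : finGroupType) (H : {group gT}) (D : diagram H)
    (S : hset H) (p : forall i, hmap S (D i)) : Prop :=
  forall (j : dedge D) x, darr j (p (dsrc j) x) = p (dtgt j) x.

Definition is_limit (gT : finGroupType) (H : {group gT}) (D : diagram H)
    (S : hset H) (p : forall i, hmap S (D i)) : Prop :=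
  is_cone p /\
  forall (T : hset H) (q : forall i, hmap T (D i)), is_cone q ->
    exists u : hmap T S, (forall i x, p i (u x) = q i x) /\
      forall v : hmap T S, (forall i x, p i (v x) = q i x) -> v =1 u.

Definition hclass (gT : finGroupType) : Type :=
  forall H : {group gT}, hset H -> Prop.

(* Closure under isomorphism is the case of one-vertex diagrams in
   [ix_limit]. *)
Record indexing_axioms (gT : finGroupType) (I : hclass gT) : Prop := {
  ix_pull : forall (H K : {group gT}) g (sKH : K \subset H :^ g) (S : hset H),
    I H S -> I K (hpull sKH S);
  ix_triv : forall (H : {group gT}) (T : finType), I H (htriv H T);
  ix_sum : forall (H : {group gT}) (S T : hset H),
    I H S -> I H T -> I H (hsum S T);
  ix_limit : forall (H : {group gT}) (D : diagram H) (S : hset H)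
      (p : forall i, hmap S (D i)),
    is_limit p -> (forall i, I H (D i)) -> I H S;
  ix_ind : forall (H K : {group gT}) (T : hset K), K \subset H ->
    I H (hquo H K) -> I K T -> I H (hind H T) }.

Record indexing (gT : finGroupType) := Indexing {
  ix_mem :> forall H : {group gT}, hset H -> Prop;
  ixP : indexing_axioms ix_mem }.

Definition ix_le (gT : finGroupType) (I J : indexing gT) : Prop :=
  forall (H : {group gT}) (S : hset H), I H S -> J H S.

Lemma complete_axioms (gT : finGroupType) :
  indexing_axioms (fun (H : {group gT}) (_ : hset H) => True).
Proof. by []. Qed.
Definition complete (gT : finGroupType) : indexing gT :=
  Indexing (complete_axioms gT).

Notation gset gT := (hset [set: gT]%G).

Section Bispans.
Variable gT : finGroupType.
Implicit Types X Y Z : gset gT.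

Record bispan X Y := Bispan {
  bdom : gset gT;
  bmid : gset gT;
  bres : hmap bdom X;
  bnrm : hmap bdom bmid;
  btr : hmap bmid Y }.

Definition biso X Y (w w' : bispan X Y) : Prop :=
  exists (a : hmap (bdom w) (bdom w')) (b : hmap (bmid w) (bmid w')),
    [/\ bijective a, bijective b,
        forall x, bres w' (a x) = bres w x,
        forall x, bnrm w' (a x) = b (bnrm w x)
      & forall y, btr w' (b y) = btr w y].

Lemma biso_refl X Y (w : bispan X Y) : biso w w.
Proof.
have idP (S : gset gT) : forall x : S, {in [set: gT],
    forall a, id (hact S x a) = hact S (id x) a} by [].
by exists (HMap (idP _)), (HMap (idP _)); split=> //; exists id.
Qed.

Definition hid X : hmap X X :=
  @HMap _ _ X X id (fun _ _ _ => erefl).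

Definition Rb X Y (f : hmap X Y) : bispan Y X := Bispan f (hid X) (hid X).
Definition Nb X Y (f : hmap X Y) : bispan X Y := Bispan (hid X) f (hid Y).
Definition Tb X Y (f : hmap X Y) : bispan X Y := Bispan (hid X) (hid X) f.

(* Composition of X <-r- A -n-> B -t-> Y and Y <-r'- C -n'-> D -t'-> Z. With
   B' = B x_Y C, the set Pi_{n'} B' consists of the pairs (d, s) where d : D and
   s is a section of B' -> C over the fibre n'^-1(d), encoded as a partial
   function C -> B defined exactly on this fibre; the composite is
     X <- (A x_B B') x_{B'} (C x_D Pi_{n'} B') -> Pi_{n'} B' -> Z,
   and the left-hand set is the set of (a, c, (d, s)) with n' c = d and
   s c = n a. *)
Section Composition.
Variables (X Y Z : gset gT) (w1 : bispan X Y) (w2 : bispan Y Z).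

Definition sec_pred (u : hprod (bmid w2) (hpfun (bdom w2) (bmid w1))) : bool :=
  [forall c, if bnrm w2 c == u.1 then omap (btr w1) (u.2 c) == Some (bres w2 c)
             else u.2 c == None].
Lemma sec_stable :
  {in [set: gT]%G, forall a u, sec_pred u ->
     sec_pred (hact (hprod (bmid w2) (hpfun (bdom w2) (bmid w1))) u a)}.
Proof.
move=> a aG [d s] /forallP sP; apply/forallP=> c.
have cE : hact (bdom w2) (hact (bdom w2) c a^-1) a = c.
  by rewrite -hactM ?inE // mulVg hact1.
move: (sP (hact (bdom w2) c a^-1)); rewrite mk_hsetE //= /ext_act aG ffunE.
have -> : (bnrm w2 (hact (bdom w2) c a^-1) == d)
        = (bnrm w2 c == hact (bmid w2) d a).
  by rewrite -(inj_eq (act_inj (hact (bmid w2)) a)) -hmapP // cE.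
case: ifP => _; last by move/eqP->.
case: (s _) => //= b /eqP[e]; apply/eqP; congr Some.
by rewrite hmapP // e -hmapP // cE.
Qed.
Definition bsec : gset gT := hsub sec_stable.

Definition pt_pred (u : hprod (hprod (bdom w1) (bdom w2)) bsec) : bool :=
  (bnrm w2 u.1.2 == (val u.2).1) && ((val u.2).2 u.1.2 == Some (bnrm w1 u.1.1)).
Lemma pt_stable :
  {in [set: gT]%G, forall g u, pt_pred u ->
     pt_pred (hact (hprod (hprod (bdom w1) (bdom w2)) bsec) u g)}.
Proof.
move=> g gG [[a c] p] /andP[/= /eqP e1 /eqP e2].
have pE : sval (ext_act [set: gT]%G (hsub_op (p:=sec_pred)) p g)
          = hact (hprod (bmid w2) (hpfun (bdom w2) (bmid w1))) (sval p) g.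
  by rewrite /ext_act gG; exact: (hsub_opE sec_stable).
rewrite /pt_pred /= /ext_act gG /= pE /= /ext_act gG /=.
rewrite hmapP // e1 eqxx /= /ext_act gG ffunE -hactM ?inE // mulgV hact1 e2 /=.
by rewrite hmapP.
Qed.
Definition bpts : gset gT := hsub pt_stable.

Lemma bcomp_resP (u : bpts) : {in [set: gT]%G, forall g,
  bres w1 (val (hact bpts u g)).1.1 = hact X (bres w1 (val u).1.1) g}.
Proof. by move=> g gG; rewrite hsubE // mk_hsetE //= /ext_act gG hmapP. Qed.
Lemma bcomp_nrmP (u : bpts) : {in [set: gT]%G, forall g,
  (val (hact bpts u g)).2 = hact bsec (val u).2 g}.
Proof. by move=> g gG; rewrite hsubE // mk_hsetE. Qed.
Lemma bcomp_trP (p : bsec) : {in [set: gT]%G, forall g,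
  btr w2 (val (hact bsec p g)).1 = hact Z (btr w2 (val p).1) g}.
Proof. by move=> g gG; rewrite hsubE // mk_hsetE //= hmapP. Qed.

Definition bcomp : bispan X Z :=
  Bispan (HMap bcomp_resP) (HMap bcomp_nrmP) (HMap bcomp_trP).
End Composition.

Definition hempty : gset gT := htriv [set: gT]%G void.
Definition from_empty X : hmap hempty X :=
  @HMap _ _ hempty X (fun v => match v with end) (fun v => match v with end).

Lemma hinlP X Y (x : X) : {in [set: gT]%G, forall a,
  inl (hact X x a) = hact (hsum X Y) (inl x) a}.
Proof. by move=> a aG; rewrite mk_hsetE. Qed.
Definition hinl X Y : hmap X (hsum X Y) := @HMap _ _ X (hsum X Y) inl (@hinlP X Y).
Lemma hinrP X Y (y : Y) : {in [set: gT]%G, forall a,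
  inr (hact Y y a) = hact (hsum X Y) (inr y) a}.
Proof. by move=> a aG; rewrite mk_hsetE. Qed.
Definition hinr X Y : hmap Y (hsum X Y) := @HMap _ _ Y (hsum X Y) inr (@hinrP X Y).
Definition fold_fun X (u : hsum X X) : X :=
  match u with inl x => x | inr x => x end.
Lemma foldP X (u : hsum X X) : {in [set: gT]%G, forall a,
  fold_fun (hact (hsum X X) u a) = hact X (fold_fun u) a}.
Proof. by move=> a aG; rewrite mk_hsetE //; case: u. Qed.
Definition hfold X : hmap (hsum X X) X := @HMap _ _ (hsum X X) X (@fold_fun X) (@foldP X).

Definition stab X (x : X) : {group gT} := 'C[x | hact X]%G.

Definition badm (I : indexing gT) X Y (w : bispan X Y) : Prop :=
  forall y : bdom w, I (stab (bnrm w y)) (hquo (stab (bnrm w y)) (stab y)).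

Section Admissibility.
Variable I : indexing gT.

Lemma ix_iso (H : {group gT}) (S T : hset H) (f : hmap S T) :
  bijective f -> I H T -> I H S.
Proof.
case=> g fK gK IT; pose D := @Diagram gT H unit void
  (fun v => match v with end) (fun v => match v with end) (fun _ => T)
  (fun v => match v with end).
apply: (@ix_limit _ _ (ixP I) H D S (fun _ => f)) => //; split=> [[]|U q _].
have uP x : {in H, forall a, g (q tt (hact U x a)) = hact S (g (q tt x)) a}.
  by move=> a aH; apply: (can_inj fK); rewrite [RHS]hmapP // !gK hmapP.
exists (@HMap _ _ U S (fun x => g (q tt x)) uP); split=> [[] x /=|v vE x /=].
  by rewrite gK.
by rewrite -(vE tt x) fK.
Qed.

Lemma ix_quo_refl (H : {group gT}) : I H (hquo H H).
Proof.
have one (C : hquo H H) : val C = H :> {set gT}.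
  by case: C => C /= /rcosetsP[h hH ->]; rewrite rcoset_id.
have fP (C : hquo H H) : {in H, forall a,
    (fun _ => tt) (hact (hquo H H) C a) = hact (htriv H unit) tt a}.
  by move=> a aH; case: (hact (htriv H unit) tt a).
have HH : (H : htrans H) \in rcosets H H.
  by apply/rcosetsP; exists 1; rewrite ?mulg1.
apply: (@ix_iso H (hquo H H) (htriv H unit)
         (@HMap _ _ (hquo H H) (htriv H unit) _ fP)); last exact: ix_triv (ixP I) _ _.
exists (fun _ => exist (fun D : htrans H => D \in rcosets H H) (H : {set gT}) HH)
  => [C|[] //].
by apply: val_inj; rewrite /= one.
Qed.

Lemma Rb_adm X Y (f : hmap X Y) : badm I (Rb f).
Proof. by move=> y; exact: ix_quo_refl. Qed.
Lemma Tb_adm X Y (f : hmap X Y) : badm I (Tb f).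
Proof. by move=> y; exact: ix_quo_refl. Qed.
Lemma fold_adm X : badm I (Nb (hfold X)).
Proof.
move=> y /=; suff -> : stab y = stab (fold_fun y) by exact: ix_quo_refl.
apply/group_inj/setP=> g.
have gG : g \in [set: gT]%G by rewrite inE.
apply/idP/idP => /astab1P yg; apply/astab1P; first by rewrite -foldP // yg.
by case: y yg => x /= xg; rewrite /ext_act gG /= xg.
Qed.
Lemma empty_adm X : badm I (Nb (from_empty X)).
Proof. by case. Qed.
End Admissibility.

Section Subcategory.
Variable I : indexing gT.

Lemma ix_inj (H : {group gT}) (S T : hset H) (f : hmap S T) :
  injective f -> I H T -> I H S.
Proof.
move=> f_inj IT.
pose V b : hset H := if b then T else htriv H bool.
have im_st x : {in H, forall a, (hact T x a \in codom f) = (x \in codom f)}.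
  have sub y : {in H, forall a, y \in codom f -> hact T y a \in codom f}.
    by move=> a aH /codomP[z ->]; rewrite -hmapP // codom_f.
  move=> a aH; apply/idP/idP => [xa|]; last exact: sub.
  by rewrite -(hact1 x) -(mulgV a) hactM ?groupV //; apply: sub; rewrite ?groupV.
have chiP x : {in H, forall a, (hact T x a \in codom f)
    = hact (htriv H bool) (x \in codom f) a}.
  by move=> a aH; rewrite mk_hsetE // im_st.
have trueP (U : hset H) (x : U) : {in H, forall a,
    true = hact (htriv H bool) true a}.
  by move=> a aH; rewrite mk_hsetE.
pose arr (j : bool) : hmap T (htriv H bool) :=
  if j then @HMap _ _ T (htriv H bool) _ chiP
  else @HMap _ _ T (htriv H bool) _ (trueP T).
pose D := @Diagram gT H bool bool (fun=> true) (fun=> false) V arr.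
pose p (i : bool) : hmap S (V i) :=
  if i is true as i return hmap S (V i) then f
  else @HMap _ _ S (htriv H bool) _ (trueP S).
have VI i : I H (V i) by case: i => //; exact: ix_triv (ixP I) _ _.
apply: (@ix_limit _ _ (ixP I) H D S p) => //; split=> [[] x /=|U q qP].
- exact: codom_f.
- by [].
have qim x : q true x \in codom f.
  exact: etrans (qP true x) (esym (qP false x)).
have uP x : {in H, forall a, iinv (qim (hact U x a)) = hact S (iinv (qim x)) a}.
  by move=> a aH; apply: f_inj; rewrite [RHS]hmapP // !f_iinv hmapP.
exists (@HMap _ _ U S (fun x => iinv (qim x)) uP).
have fu x : f (iinv (qim x)) = q true x by rewrite f_iinv.
split=> [[] x /=|v vE x /=]; first exact: fu.
  exact: qP false x.
by apply: f_inj; rewrite fu -(vE true x).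
Qed.

Lemma rcoset_quo (H K : {group gT}) h : h \in H -> K :* h \in rcosets K H.
Proof. by move=> hH; apply/rcosetsP; exists h. Qed.

Definition quo_pt (H K : {group gT}) h (hH : h \in H) : hquo H K :=
  exist (fun C : htrans H => C \in rcosets K H) _ (rcoset_quo K hH).

Lemma quo_ptM (H K : {group gT}) h (hH : h \in H) a (aH : a \in H) :
  hact (hquo H K) (quo_pt K hH) a = quo_pt K (groupM hH aH).
Proof.
by apply: val_inj; rewrite hsubE // mk_hsetE //= /trans_op -rcosetM.
Qed.

Lemma quo_ptP (H K : {group gT}) (C : hquo H K) :
  exists h (hH : h \in H), C = quo_pt K hH.
Proof.
case: C => C CP; have /rcosetsP[h hH Ch] := CP.
by exists h, hH; apply: val_inj.
Qed.

Lemma quo_pt_eq (H K : {group gT}) g h (gH : g \in H) (hH : h \in H) :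
  (quo_pt K gH == quo_pt K hH) = (g * h^-1 \in K).
Proof.
rewrite -val_eqE /= -mem_rcoset.
by apply/eqP/idP => /rcoset_eqP.
Qed.

Lemma capP (H : {group gT}) (S : hset H) (x : S) k :
  (k \in 'C_H[x | hact S]) = (k \in H) && (hact S x k == x).
Proof. by rewrite !inE sub1set inE andbA andbb. Qed.

Lemma ix_quo_stab (H K : {group gT}) (S : hset H) (x : S) :
  K :=: 'C_H[x | hact S] -> I H S -> I H (hquo H K).
Proof.
move=> KE; have KP k : (k \in K) = (k \in H) && (hact S x k == x).
  by rewrite KE capP.
have sKH k : k \in K -> k \in H by rewrite KP => /andP[].
pose f (C : hquo H K) : S := hact S x (repr (val C)).
have fE h (hH : h \in H) : f (quo_pt K hH) = hact S x h.
  rewrite /f /=; have /rcosetP[k kK ->] := mem_repr_rcoset K h.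
  have := kK; rewrite KP => /andP[kH /eqP xk]; by rewrite hactM // xk.
have fP C : {in H, forall a, f (hact (hquo H K) C a) = hact S (f C) a}.
  by move=> a aH; have [h [hH ->]] := quo_ptP C; rewrite quo_ptM !fE hactM.
apply: (@ix_inj H (hquo H K) S (HMap fP)) => C D /=.
have [g [gH ->]] := quo_ptP C; have [h [hH ->]] := quo_ptP D.
rewrite !fE => e; apply/eqP; rewrite quo_pt_eq KP groupM ?groupV //=.
by rewrite hactM ?groupV // e -hactM ?groupV // mulgV hact1.
Qed.

Lemma ix_quo_cap (H J K : {group gT}) : J \subset H -> K \subset H ->
  I H (hquo H J) -> I K (hquo K (K :&: J)).
Proof.
move=> sJH sKH IH; have sKH1 : K \subset H :^ 1 by rewrite conjsg1.
apply: (@ix_quo_stab K _ (hpull sKH1 (hquo H J)) (quo_pt J (group1 H))).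
  apply/setP=> k; rewrite capP in_setI; case kK: (k \in K) => //=.
  have kH := subsetP sKH _ kK.
  rewrite /ext_act kK /hpull_op invg1 conjg1 quo_ptM quo_pt_eq.
  by rewrite invg1 mulg1 mul1g.
exact: ix_pull (ixP I) _ _ _ _ _ IH.
Qed.

Lemma ix_quo_trans (H K L : {group gT}) : K \subset H -> L \subset K ->
  I H (hquo H K) -> I K (hquo K L) -> I H (hquo H L).
Proof.
move=> sKH sLK IH IK; pose T := hquo K L; pose t : T := quo_pt L (group1 K).
have tk k : k \in K -> (hact T t k == t) = (k \in L).
  move=> kK; rewrite quo_ptM quo_pt_eq.
  by rewrite invg1 mulg1 mul1g.
have cP : [exists t', exists h in H, ind_class t 1 == ind_class (T := T) t' h].
  by apply/existsP; exists t; apply/exists_inP; exists 1.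
pose c : hind H T := exist (fun C : hind_amb H T =>
  [exists t', exists h in H, C == ind_class t' h]) _ cP.
apply: (@ix_quo_stab H L (hind H T) c); last exact: ix_ind (ixP I) _ _ _ sKH IH IK.
apply/setP=> h; rewrite capP.
case hH: (h \in H); rewrite ?andTb ?andFb; last first.
  by apply/negP=> /(subsetP sLK)/(subsetP sKH); rewrite hH.
rewrite -val_eqE hsubE // mk_hsetE //= ind_op_class mul1g.
apply/idP/eqP=> [hL|/setP/(_ (t, h))].
  have hK := subsetP sLK _ hL; have th : hact T t h = t by apply/eqP; rewrite tk.
  apply/setP=> u; apply/imsetP/imsetP => -[k kK ->].
    exists (h^-1 * k); first by rewrite groupM ?groupV.
    have -> : hact T t k = hact T t (h^-1 * k).
      by rewrite -{2}th -hactM ?groupM ?groupV // mulKVg.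
    by rewrite invMg invgK mulg1.
  exists (h * k); first by rewrite groupM.
  by rewrite hactM // th invMg mulgKV mulg1.
have -> : (t, h) \in ind_class t h.
  by apply/imsetP; exists 1; rewrite // hact1 invg1 mul1g.
move=> /esym/imsetP[k kK [/esym tkE ->]]; rewrite mulg1 groupV -tk //.
by apply/eqP; apply: tkE.
Qed.

Lemma stabP X (x : X) g : (g \in stab x) = (hact X x g == x).
Proof. by rewrite !inE sub1set inE. Qed.

Lemma stab_map X Y (f : hmap X Y) (x : X) : stab x \subset stab (f x).
Proof.
by apply/subsetP=> g; rewrite !stabP => /eqP e; rewrite -hmapP ?inE // e.
Qed.

Lemma bcomp_adm X Y Z (w1 : bispan X Y) (w2 : bispan Y Z) :
  badm I w1 -> badm I w2 -> badm I (bcomp w1 w2).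
Proof.
move=> h1 h2 [[[a c] p] uP].
have gG g : g \in [set: gT]%G by rewrite inE.
pose u : bpts w1 w2 := exist (@pt_pred X Y Z w1 w2) ((a, c), p) uP.
pose H : {group gT} := stab p; change (I H (hquo H (stab u))).
have /andP[/= /eqP e1 /eqP e2] := uP.
have HE g : g \in H -> hact (bmid w2) (val p).1 g = (val p).1 /\
    forall x, omap (fun y => hact (bmid w1) y g) ((val p).2 x) = (val p).2 (hact (bdom w2) x g).
  rewrite stabP => /eqP/(congr1 val); rewrite hsubE // mk_hsetE //.
  move=> e; split; first by move/(congr1 fst): (e).
  move=> x; move/(congr1 snd): e => /= /ffunP/(_ (hact (bdom w2) x g)).
  by rewrite /ext_act gG ffunE -hactM // mulgV hact1.
have sHd : H \subset stab (bnrm w2 c).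
  by apply/subsetP=> g /HE[e _]; rewrite stabP e1; apply/eqP; exact: e.
pose K := (H :&: stab c)%G.
have IK : I H (hquo H K) := ix_quo_cap (stab_map _ _) sHd (h2 c).
have sKa : K \subset stab (bnrm w1 a).
  apply/subsetP=> g /setIP[/HE[_ /(_ c)]]; rewrite !stabP => + /eqP gc.
  by rewrite gc e2 => -[] e; apply/eqP.
have IL : I K (hquo K (K :&: stab a)) := ix_quo_cap (stab_map _ _) sKa (h1 a).
have := ix_quo_trans (subsetIl _ _) (subsetIl _ _) IK IL.
suff -> : (K :&: stab a)%G = stab u by [].
apply/group_inj/setP=> g; rewrite (in_setI g K (stab a)) (in_setI g H (stab c)) !stabP.
have opE : hact (hprod (hprod (bdom w1) (bdom w2)) (bsec w1 w2)) ((a, c), p) g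
  = ((hact (bdom w1) a g, hact (bdom w2) c g), hact (bsec w1 w2) p g).
  by rewrite mk_hsetE // /hprod_op [X in (X, _)]mk_hsetE.
rewrite -andbA; apply/and3P/eqP => [[/eqP ep /eqP ec /eqP ea]|/(congr1 val)].
  by apply: val_inj; rewrite hsubE // [val u]/= opE ea ec ep.
rewrite hsubE // [val u]/= opE => e.
have {e} [ea ec ep] : (hact (bdom w1) a g, hact (bdom w2) c g, hact (bsec w1 w2) p g)
  = (a, c, p) := e.
by split; apply/eqP.
Qed.
End Subcategory.
End Bispans.

Arguments Rb_adm {gT} I {X Y} f.
Arguments Tb_adm {gT} I {X Y} f.
Arguments fold_adm {gT} I X.
Arguments empty_adm {gT} I X.

(* A product-preserving functor on the bispans that are admissible for I. In the
   category of bispans the product of X and Y is their disjoint union, with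
   projections the restrictions along the two inclusions, and the empty G-set is
   terminal; [tpair] is inverse to the comparison map. By [bcomp_adm] the
   admissible bispans are closed under composition. *)
Record bifunctor (gT : finGroupType) (I : indexing gT) := Bifunctor {
  tob :> gset gT -> Type;
  tmor : forall (X Y : gset gT) (w : bispan X Y), badm I w -> tob X -> tob Y;
  tmor_iso : forall (X Y : gset gT) (w w' : bispan X Y)
      (hw : badm I w) (hw' : badm I w'),
    biso w w' -> tmor hw =1 tmor hw';
  tmor_id : forall (X : gset gT) (h : badm I (Rb (hid X))), tmor h =1 id;
  tmor_comp : forall (X Y Z : gset gT) (w1 : bispan X Y) (w2 : bispan Y Z)
      (h1 : badm I w1) (h2 : badm I w2) (h12 : badm I (bcomp w1 w2)),
    tmor h12 =1 tmor h2 \o tmor h1;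
  tpt : tob (hempty gT);
  tptP : forall x : tob (hempty gT), x = tpt;
  tpair : forall X Y : gset gT, tob X -> tob Y -> tob (hsum X Y);
  tpairl : forall (X Y : gset gT) (x : tob X) (y : tob Y),
    tmor (Rb_adm I (hinl X Y)) (tpair x y) = x;
  tpairr : forall (X Y : gset gT) (x : tob X) (y : tob Y),
    tmor (Rb_adm I (hinr X Y)) (tpair x y) = y;
  tpair_eta : forall (X Y : gset gT) (z : tob (hsum X Y)),
    tpair (tmor (Rb_adm I (hinl X Y)) z) (tmor (Rb_adm I (hinr X Y)) z) = z }.

Section Operations.
Variables (gT : finGroupType) (I : indexing gT) (F : bifunctor I).
Implicit Types X Y : gset gT.

Definition tres X Y (f : hmap X Y) : F Y -> F X := tmor (Rb_adm I f).
Definition ttr X Y (f : hmap X Y) : F X -> F Y := tmor (Tb_adm I f).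
Definition tadd X (x y : F X) : F X := ttr (hfold X) (tpair x y).
Definition tzero X : F X := ttr (from_empty X) (tpt F).
Definition tmul X (x y : F X) : F X := tmor (fold_adm I X) (tpair x y).
Definition tone X : F X := tmor (empty_adm I X) (tpt F).
Definition tmuln X (x : F X) (n : nat) : F X := iter n (tadd x) (tzero X).
Definition texp X (x : F X) (n : nat) : F X := iter n (tmul x) (tone X).
Definition tunit X (x : F X) : Prop := exists y, tmul x y = tone X.
End Operations.
Arguments tzero {gT I F X}.
Arguments tone {gT I F X}.

Record itambara (gT : finGroupType) (I : indexing gT) := ITambara {
  tfun :> bifunctor I;
  taddA : forall (X : gset gT) (x y z : tfun X),
    tadd x (tadd y z) = tadd (tadd x y) z;
  taddC : forall (X : gset gT) (x y : tfun X), tadd x y = tadd y x;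
  tadd0 : forall (X : gset gT) (x : tfun X), tadd x tzero = x;
  taddN : forall (X : gset gT) (x : tfun X), exists y, tadd x y = tzero }.

Notation tambara gT := (itambara (complete gT)).

Record tmap (gT : finGroupType) (I : indexing gT) (A B : itambara I) := TMap {
  tmapf :> forall X : gset gT, A X -> B X;
  tmapP : forall (X Y : gset gT) (w : bispan X Y) (hw : badm I w) (x : A X),
    tmapf (tmor hw x) = tmor hw (tmapf x) }.

Section Forget.
Variables (gT : finGroupType) (I : indexing gT) (A : tambara gT).

Definition cadm (X Y : gset gT) (w : bispan X Y) : badm (complete gT) w :=
  fun _ => Logic.I.
Arguments cadm {X Y} w.

Lemma tmor_irr (X Y : gset gT) (w : bispan X Y) (h h' : badm (complete gT) w) :
  tmor (b := A) h =1 tmor h'.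
Proof. exact: tmor_iso (biso_refl w). Qed.

Lemma forget_pairl (X Y : gset gT) (x : A X) (y : A Y) :
  tmor (cadm (Rb (hinl X Y))) (tpair x y) = x.
Proof. by rewrite (tmor_irr _ (Rb_adm _ _)) tpairl. Qed.
Lemma forget_pairr (X Y : gset gT) (x : A X) (y : A Y) :
  tmor (cadm (Rb (hinr X Y))) (tpair x y) = y.
Proof. by rewrite (tmor_irr _ (Rb_adm _ _)) tpairr. Qed.
Lemma forget_pair_eta (X Y : gset gT) (z : A (hsum X Y)) :
  tpair (tmor (cadm (Rb (hinl X Y))) z) (tmor (cadm (Rb (hinr X Y))) z) = z.
Proof. by rewrite !(tmor_irr _ (Rb_adm _ _)) tpair_eta. Qed.

Definition forget_fun : bifunctor I :=
  @Bifunctor gT I A (fun X Y w _ => tmor (cadm w))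
    (fun X Y w w' _ _ => tmor_iso (b := A) (cadm w) (cadm w'))
    (fun X _ => tmor_id (b := A) (cadm _))
    (fun X Y Z w1 w2 _ _ _ => tmor_comp (b := A) (cadm w1) (cadm w2) (cadm _))
    (tpt A) (@tptP _ _ A) (@tpair _ _ A)
    forget_pairl forget_pairr forget_pair_eta.

Lemma forget_add (X : gset gT) (x y : A X) :
  tadd (F := forget_fun) x y = tadd x y.
Proof. exact: tmor_irr. Qed.
Lemma forget_zero (X : gset gT) : tzero (F := forget_fun) = tzero :> A X.
Proof. exact: tmor_irr. Qed.

Lemma forget_addA (X : gset gT) (x y z : forget_fun X) :
  tadd x (tadd y z) = tadd (tadd x y) z.
Proof. by rewrite !forget_add taddA. Qed.
Lemma forget_addC (X : gset gT) (x y : forget_fun X) : tadd x y = tadd y x.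
Proof. by rewrite !forget_add taddC. Qed.
Lemma forget_add0 (X : gset gT) (x : forget_fun X) : tadd x tzero = x.
Proof. by rewrite forget_zero forget_add tadd0. Qed.
Lemma forget_addN (X : gset gT) (x : forget_fun X) :
  exists y, tadd x y = tzero.
Proof.
have [y xy] := taddN (x : A X).
by exists y; rewrite forget_zero forget_add.
Qed.

Definition forget : itambara I :=
  ITambara forget_addA forget_addC forget_add0 forget_addN.
End Forget.

Section Levels.
Variable gT : finGroupType.
Implicit Types H K : {group gT}.

(* The value of a Tambara functor F at the subgroup H is F (orb H). *)
Definition orb H : gset gT := hquo [set: gT]%G H.

Lemma top_subproof : ([set: gT] : htrans [set: gT]%G) \in
  rcosets [set: gT] [set: gT].
Proof. by apply/rcosetsP; exists 1; rewrite ?inE ?mulg1. Qed.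
Definition top_pt : orb [set: gT]%G :=
  exist (fun C : htrans [set: gT]%G => C \in rcosets [set: gT] [set: gT])
    _ top_subproof.
Lemma to_topP H (C : orb H) : {in [set: gT]%G, forall a,
  top_pt = hact (orb [set: gT]%G) top_pt a}.
Proof.
move=> a aG; apply: val_inj; rewrite hsubE // mk_hsetE //= /trans_op.
by rewrite rcoset_id.
Qed.
Definition to_top H : hmap (orb H) (orb [set: gT]%G) :=
  @HMap _ _ (orb H) (orb [set: gT]%G) (fun _ => top_pt) (@to_topP H).

(* [S] : F (orb H) for a finite H-set S, namely the transfer of 1 along
   G x_H S -> G/H. Functoriality on bispans then says that restrictions,
   transfers and norms of such classes are computed on finite sets by pullback,
   induction and co-induction. *)
Definition tclass (I : indexing gT) (F : bifunctor I) H (S : hset H) :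
  F (orb H) := ttr (hind_proj [set: gT]%G S) tone.

(* A is the Burnside Tambara functor localized at P: for every H, the additive
   group A(orb H) together with S |-> [S] is the Grothendieck group of the
   monoid of isomorphism classes of finite H-sets, tensored with Z_(P). Here a
   P^'-number is a product of primes not in P, and [iter n (hsum S) U] is the
   disjoint union of n copies of S and of U. *)
Record local_burnside (P : nat_pred) (A : tambara gT) : Prop := {
  lb_local : forall H n (a : A (orb H)), P^'.-nat n ->
    exists! b : A (orb H), tmuln b n = a;
  lb_gen : forall H (a : A (orb H)), exists n (S S' : hset H),
    P^'.-nat n /\ tadd (tmuln a n) (tclass A S') = tclass A S;
  lb_rel : forall H (S S' : hset H), tclass A S = tclass A S' ->
    exists n (U : hset H),
      P^'.-nat n /\ hiso (iter n (hsum S) U) (iter n (hsum S') U) }.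

(* Z_(P) is realized inside rat, as the fractions with P^'-number denominator. *)
Record is_mark (P : nat_pred) (A : tambara gT) (Q : {group gT})
    (phi : A (orb [set: gT]%G) -> rat) : Prop := {
  mark_local : forall a, P^'.-nat `|denq (phi a)|%N;
  mark_add : forall a b, phi (tadd a b) = (phi a + phi b)%R;
  mark_one : phi tone = 1%R;
  mark_mul : forall a b, phi (tmul a b) = (phi a * phi b)%R;
  mark_class : forall S : gset gT,
    phi (tclass A S) = (#|'Fix_(hact S)(Q)|%:R)%R }.

Definition primitive_idempotent (I : indexing gT) (F : bifunctor I)
    (X : gset gT) (e : F X) : Prop :=
  [/\ tmul e e = e, e <> tzero &
      forall f g : F X, tmul f f = f -> tmul g g = g -> tmul f g = tzero ->
        e = tadd f g -> f = tzero \/ g = tzero].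

(* O^P(Q), by [solv_resP] the smallest normal subgroup with solvable P-quotient;
   MathComp's 'O^P(Q) does not ask for solvability. *)
Definition solv_res_pred (P : nat_pred) (Q N : {group gT}) : bool :=
  [&& N <| Q, solvable (Q / N) & P.-group (Q / N)].
Definition solv_res (P : nat_pred) (Q : {group gT}) : {group gT} :=
  (\bigcap_(N : {group gT} | solv_res_pred P Q N) N)%G.

Lemma solv_res_predI (P : nat_pred) (Q M N : {group gT}) :
  solv_res_pred P Q M -> solv_res_pred P Q N -> solv_res_pred P Q (M :&: N).
Proof.
case/and3P=> nM sM pM /and3P[nN sN pN]; have nI := normalI nM nN.
have nMI : (M / (M :&: N))%g <| Q / (M :&: N) by apply: quotient_normal.
have isoQ := third_isog (subsetIl M N) nI nM.
have isoM : M / (N :&: M) \isog M / N.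
  by apply: second_isog; rewrite (subset_trans (normal_sub nM)) ?normal_norm.
rewrite setIC in isoM.
have sMQ : M / N \subset Q / N by rewrite quotientS ?normal_sub.
apply/and3P; split=> //.
  rewrite (series_sol nMI) (isog_sol isoQ) sM andbT (isog_sol isoM).
  exact: solvableS sMQ sN.
rewrite /pgroup -(Lagrange (normal_sub nMI)) pnatM.
rewrite -(card_quotient (normal_norm nMI)) (card_isog isoQ) (card_isog isoM).
by rewrite [X in _ && X]pM andbT; exact: pgroupS sMQ pN.
Qed.

Lemma solv_resP (P : nat_pred) (Q : {group gT}) :
  solv_res_pred P Q (solv_res P Q) /\
  forall N : {group gT}, solv_res_pred P Q N -> solv_res P Q \subset N.
Proof.
split=> [|N QN]; last exact: bigcap_inf.
have QQ : solv_res_pred P Q Q.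
  by rewrite /solv_res_pred normal_refl trivg_quotient solvable1 pgroup1.
have RP (s : seq {group gT}) : exists2 M : {group gT}, solv_res_pred P Q M &
    M :=: Q :&: \bigcap_(N <- s | solv_res_pred P Q N) N.
  elim: s => [|N s [M QM ME]]; first by exists Q; rewrite ?big_nil ?setIT.
  case QN: (solv_res_pred P Q N); last by exists M; rewrite // big_cons QN.
  exists (N :&: M)%G; first exact: solv_res_predI.
  by rewrite big_cons QN setICA -ME.
have [M QM ME] := RP (index_enum {group gT}).
suff -> : solv_res P Q = M by [].
apply: group_inj; rewrite ME; apply/esym/setIidPr.
by apply: (bigcap_inf Q).
Qed.

Definition star (L H K : {group gT}) : Prop :=
  forall x, L :^ x \subset H -> L :^ x \subset K.

Definition admissible (L : {group gT}) (H : {group gT}) (S : hset H) : Prop :=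
  forall x : S, star L H 'C_H[x | hact S]%G.

(* B is a levelwise localization of A at e: for every H the ring map
   A(orb H) -> B(orb H) exhibits its target as the ring of fractions of
   A(orb H) with respect to the powers of the restriction of e. *)
Record is_localization (I : indexing gT) (A B : itambara I) (eta : tmap A B)
    (e : A (orb [set: gT]%G)) : Prop := {
  loc_unit : forall H, tunit (eta _ (tres (to_top H) e));
  loc_surj : forall H (b : B (orb H)), exists (a : A (orb H)) k,
    tmul b (eta _ (texp (tres (to_top H) e) k)) = eta _ a;
  loc_inj : forall H (a a' : A (orb H)), eta _ a = eta _ a' -> exists k,
    tmul (texp (tres (to_top H) e) k) a
    = tmul (texp (tres (to_top H) e) k) a' }.

(* A[e^-1] is given up to unique isomorphism by [is_localization]. Its Green ring
   structure needs no separate mention: it is the only one for which eta is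
   compatible with restrictions, transfers and products. *)
Definition tambara_under (A : tambara gT) (e : A (orb [set: gT]%G))
    (J : indexing gT) : Prop :=
  exists (B : itambara J) (eta : tmap (forget J A) B),
    is_localization eta (e : forget J A (orb [set: gT]%G)).

Definition is_initial_inverting (I : indexing gT) (A B : itambara I)
    (eta : tmap A B) (e : A (orb [set: gT]%G)) : Prop :=
  tunit (eta _ e) /\
  forall (R : itambara I) (psi : tmap A R), tunit (psi _ e) ->
    exists theta : tmap B R,
      (forall (X : gset gT) (a : A X), theta _ (eta _ a) = psi _ a) /\
      forall theta' : tmap B R,
        (forall (X : gset gT) (a : A X), theta' _ (eta _ a) = psi _ a) ->
        forall (X : gset gT) (b : B X), theta' _ b = theta _ b.
End Levels.

(* Main.v *)
Require Import Defs.
From mathcomp Require Import all_boot all_order all_fingroup all_solvable all_algebra.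
From Stdlib Require Import ProofIrrelevance IndefiniteDescription.

Set Implicit Arguments.
Unset Strict Implicit.
Unset Printing Implicit Defensive.

Import GroupScope.

(** Every value [A X] of the Burnside functor is spanned, up to denominators prime
    to [P], by classes [cls f] of finite sets [f : S -> X]. For [Q] fixing [x : X]
    there is a mark [mark_at Q x] on [A X] counting the [Q]-fixed points over [x],
    and these marks together are injective ([mark_inj]).

    The theorem rests on computing the marks of a norm along [f : Y -> Z] at a
    point [z]. After base change to an orbit the fibre splits into [Q]-orbits and
    norms turn disjoint unions into products. On a single [Q]-orbit through [y],
    the mark of the norm of [a] is the mark of [a] at [y] for the stabilizer of
    [y] in [Q] ([mark_nrm_transitive]): it is additive in [a], since all but two
    sections of a fold map move under [Q], and on classes it counts equivariant
    sections. So the norm of the restriction of [e] has mark [1] at [Q] if all the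
    groups [Q :&: stab y] have residual conjugate to [L], and [0] otherwise.

    Let the residual of [Q] be a conjugate of [L]. If [f] is admissible, this
    residual lies in every stabilizer of the fibre, hence is the residual of every
    [Q :&: stab y]. Thus [e * N e = e] for admissible norms ([nrm_spread_adm]), and
    by Frobenius reciprocity [e * w (e * x) = e * w x] for every admissible bispan
    [w]: the summands [e * A X] carry the operations [e * w], and they are the
    localization. Conversely, if the norm from [K] to [H] descends to the
    localization, then it sends [1] to [1], so that [e * N e = e] at [H]; for a
    conjugate [Q] of [L] inside [H] the mark at [Q] then forces [Q :&: K] to have a
    residual of order [#|L|], so [Q] lies in [K] ([admissible_maximal]).

    Finally, a localization at an idempotent is levelwise surjective, and elements
    with equal images have equal products with [e]. Any map inverting [e] sends it
    to [1], so it factors uniquely, and the factorization commutes with whatever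
    operations the two maps commute with ([loc_initial]). *)

(** * Finite [G]-sets *)

Lemma inj_surj_bij (S T : finType) (f : S -> T) :
  injective f -> (forall y, exists x, f x = y) -> bijective f.
Proof.
move=> fI fS; apply: inj_card_bij => //.
rewrite -(card_codom fI); apply: subset_leq_card; apply/subsetP=> y _.
by have [x <-] := fS y; apply: codom_f.
Qed.

Section GSets.
Variable gT : finGroupType.
Implicit Types X Y Z W V S : gset gT.

Lemma hmapG X Y (f : hmap X Y) x g : f (hact X x g) = hact Y (f x) g.
Proof. by rewrite hmapP ?inE. Qed.

Lemma hactMG X x g h : hact X x (g * h) = hact X (hact X x g) h.
Proof. by rewrite hactM ?inE. Qed.

Lemma hactK X g : cancel (fun x => hact X x g) (fun x => hact X x g^-1).
Proof. by move=> x; rewrite -hactMG mulgV hact1. Qed.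

Lemma hactKV X g : cancel (fun x => hact X x g^-1) (fun x => hact X x g).
Proof. by move=> x; rewrite -hactMG mulVg hact1. Qed.

Lemma hsum_actE X Y u g : hact (hsum X Y) u g = hsum_op u g.
Proof. by rewrite mk_hsetE ?inE. Qed.

Lemma hprod_actE X Y u g : hact (hprod X Y) u g = hprod_op u g.
Proof. by rewrite mk_hsetE ?inE. Qed.

Lemma hsub_actE X (p : pred X) (pH : {in [set: gT]%G, forall a x, p x -> p (hact X x a)})
  (u : hsub pH) g : val (hact (hsub pH) u g) = hact X (val u) g.
Proof. by rewrite hsubE ?inE. Qed.

Definition gmap X Y (f : X -> Y) (fP : forall x g, f (hact X x g) = hact Y (f x) g) :
  hmap X Y := HMap (fun x a _ => fP x a).

Lemma hcomp_subproof X Y Z (g : hmap Y Z) (f : hmap X Y) x a :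
  g (f (hact X x a)) = hact Z (g (f x)) a.
Proof. by rewrite !hmapG. Qed.
Definition hcomp X Y Z (g : hmap Y Z) (f : hmap X Y) : hmap X Z :=
  gmap (hcomp_subproof g f).

Definition copair_fun X Y Z (f : X -> Z) (g : Y -> Z) (u : hsum X Y) : Z :=
  match u with inl x => f x | inr y => g y end.
Lemma copair_subproof X Y Z (f : hmap X Z) (g : hmap Y Z) u a :
  copair_fun f g (hact (hsum X Y) u a) = hact Z (copair_fun f g u) a.
Proof. by rewrite hsum_actE; case: u => x /=; rewrite hmapG. Qed.
Definition copair X Y Z (f : hmap X Z) (g : hmap Y Z) : hmap (hsum X Y) Z :=
  gmap (copair_subproof f g).

Definition summap X Y X' Y' (f : hmap X X') (g : hmap Y Y') :
  hmap (hsum X Y) (hsum X' Y') :=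
  copair (hcomp (hinl X' Y') f) (hcomp (hinr X' Y') g).

Record is_pullback V X W Y (p : hmap V X) (q : hmap V W) (f : hmap X Y)
    (g : hmap W Y) : Prop := IsPullback {
  pb_comm : forall v, f (p v) = g (q v);
  pb_ex : forall x w, f x = g w -> exists2 v, p v = x & q v = w;
  pb_inj : forall v v', p v = p v' -> q v = q v' -> v = v' }.

Section Pullback.
Variables (X W Y : gset gT) (f : hmap X Y) (g : hmap W Y).
Definition pull_pred (u : hprod X W) : bool := f u.1 == g u.2.
Lemma pull_stable : {in [set: gT]%G, forall a u, pull_pred u ->
  pull_pred (hact (hprod X W) u a)}.
Proof.
by move=> a aG u /eqP e; rewrite /pull_pred hprod_actE /= !hmapG e.
Qed.
Definition pull : gset gT := hsub pull_stable.
Lemma pull_fst_subproof (u : pull) a :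
  (val (hact pull u a)).1 = hact X (val u).1 a.
Proof. by rewrite hsub_actE hprod_actE. Qed.
Definition pull_fst : hmap pull X := gmap pull_fst_subproof.
Lemma pull_snd_subproof (u : pull) a :
  (val (hact pull u a)).2 = hact W (val u).2 a.
Proof. by rewrite hsub_actE hprod_actE. Qed.
Definition pull_snd : hmap pull W := gmap pull_snd_subproof.
Lemma pullP : is_pullback pull_fst pull_snd f g.
Proof.
split=> [v|x w e|[[x w] u] [[x' w'] u'] /= ex ew].
- exact/eqP/(valP v).
- have uP : pull_pred (x, w) by apply/eqP.
  by exists (exist pull_pred (x, w) uP).
- by apply: val_inj; rewrite /= ex ew.
Qed.
End Pullback.

(** * Recognizing composites of bispans *)

(** The composite bispan is determined by universal properties: over a point of
    the middle set of the second bispan lie the sections along its norm fibre.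
    This criterion reads them off from a family [sec], whose values matter only
    on the fibre, so each composite below is recognised by giving [sec]. *)
Section Composite.
Variables (X Y Z : gset gT).
Variables (w1 : bispan X Y) (w2 : bispan Y Z) (w3 : bispan X Z).
Variables (al : bmid w3 -> bmid w2) (sec : bmid w3 -> bdom w2 -> bmid w1).
Variables (be : bdom w3 -> bdom w1) (ga : bdom w3 -> bdom w2).
Hypothesis alG : forall d g, al (hact _ d g) = hact _ (al d) g.
Hypothesis secG : forall d c g, bnrm w2 c = al d ->
  sec (hact _ d g) (hact _ c g) = hact _ (sec d c) g.
Hypothesis beG : forall x g, be (hact _ x g) = hact _ (be x) g.
Hypothesis gaG : forall x g, ga (hact _ x g) = hact _ (ga x) g.
Hypothesis al_tr : forall d, btr w2 (al d) = btr w3 d.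
Hypothesis sec_tr : forall d c, bnrm w2 c = al d -> btr w1 (sec d c) = bres w2 c.
Hypothesis sec_inj : forall d d', al d = al d' ->
  (forall c, bnrm w2 c = al d -> sec d c = sec d' c) -> d = d'.
Hypothesis sec_ex : forall d0 (s : bdom w2 -> option (bmid w1)),
  (forall c, bnrm w2 c = d0 -> exists2 b, s c = Some b & btr w1 b = bres w2 c) ->
  exists2 d, al d = d0 & forall c, bnrm w2 c = d0 -> s c = Some (sec d c).
Hypothesis ga_nrm : forall x, bnrm w2 (ga x) = al (bnrm w3 x).
Hypothesis be_nrm : forall x, bnrm w1 (be x) = sec (bnrm w3 x) (ga x).
Hypothesis be_res : forall x, bres w1 (be x) = bres w3 x.
Hypothesis pt_inj : forall x x', be x = be x' -> ga x = ga x' ->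
  bnrm w3 x = bnrm w3 x' -> x = x'.
Hypothesis pt_ex : forall a c d, bnrm w2 c = al d -> sec d c = bnrm w1 a ->
  exists x, [/\ be x = a, ga x = c & bnrm w3 x = d].

Let secf d : {ffun bdom w2 -> option (bmid w1)} :=
  [ffun c => if bnrm w2 c == al d then Some (sec d c) else None].
Let amb := hprod (bmid w2) (hpfun (bdom w2) (bmid w1)).

Lemma composite_secP d : sec_pred ((al d, secf d) : amb).
Proof.
apply/forallP=> c /=; rewrite ffunE.
by have [e|//] := altP (bnrm w2 c =P al d); rewrite /= sec_tr.
Qed.
Definition composite_mid_fun d : bsec w1 w2 :=
  exist (@sec_pred _ _ _ _ w1 w2) ((al d, secf d) : amb) (composite_secP d).

Lemma bsec_actE (p : bsec w1 w2) g : val (hact (bsec w1 w2) p g) =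
  (hact _ (val p).1 g,
   [ffun c => omap (fun y => hact _ y g) ((val p).2 (hact _ c g^-1))]).
Proof.
rewrite hsub_actE hprod_actE /hprod_op; congr pair.
by rewrite mk_hsetE ?inE.
Qed.

Lemma composite_mid_subproof d g :
  composite_mid_fun (hact _ d g) = hact _ (composite_mid_fun d) g.
Proof.
apply: val_inj; rewrite bsec_actE /= alG; congr pair.
apply/ffunP=> c; rewrite !ffunE -{1}(hactKV g c) hmapG alG.
rewrite (inj_eq (act_inj (hact (bmid w2)) g)); case: ifP => //= /eqP e.
by rewrite -{1}(hactKV g c) secG.
Qed.
Let mid := gmap composite_mid_subproof.

Lemma composite_ptP x : pt_pred (((be x, ga x), mid (bnrm w3 x)) :
  hprod (hprod (bdom w1) (bdom w2)) (bsec w1 w2)).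
Proof. by rewrite /pt_pred /= ga_nrm eqxx ffunE ga_nrm eqxx be_nrm /=. Qed.
Definition composite_dom_fun x : bpts w1 w2 := exist (@pt_pred _ _ _ _ w1 w2)
  (((be x, ga x), mid (bnrm w3 x)) :
     hprod (hprod (bdom w1) (bdom w2)) (bsec w1 w2)) (composite_ptP x).
Lemma composite_dom_subproof x g :
  composite_dom_fun (hact _ x g) = hact _ (composite_dom_fun x) g.
Proof.
apply: val_inj; rewrite hsub_actE hprod_actE /hprod_op hprod_actE /hprod_op.
rewrite [LHS]/=; congr (_, _, _); [exact: beG|exact: gaG|].
by rewrite hmapG [LHS]composite_mid_subproof.
Qed.

Lemma composite_mid_bij : bijective mid.
Proof.
apply: inj_surj_bij => [d d' /(congr1 val)[e /ffunP es]|[[d0 s] sP]].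
  apply: sec_inj => // c ec; move: (es c); rewrite !ffunE -e ec eqxx.
  by case.
have /forallP sE := sP; have [|d dE ds] := @sec_ex d0 s.
  move=> c /eqP ec; move: (sE c); rewrite /= ec.
  by case: (s c) => //= b /eqP[e]; exists b.
exists d; apply: val_inj => /=; rewrite dE; congr pair.
apply/ffunP=> c; rewrite ffunE dE; move: (sE c) => /=.
by case: ifP => [/eqP ec _|_ /eqP->] //; rewrite ds.
Qed.

Lemma bcomp_biso : biso w3 (bcomp w1 w2).
Proof.
exists (gmap composite_dom_subproof), mid; split=> //.
  apply: inj_surj_bij => [x x' /(congr1 val)[eb eg em es]|[[[a c] p] uP]].
    apply: pt_inj => //; apply: (bij_inj composite_mid_bij).
    apply: val_inj; exact: (congr2 pair em es).
  have /andP[/= /eqP e1 /eqP e2] := uP.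
  have [mid' _ mK] := composite_mid_bij.
  have [] := @pt_ex a c (mid' p) => [||x [xa xc xd]].
  - by rewrite e1 -[in LHS](mK p).
  - move: e2; rewrite -{1}(mK p) /= ffunE.
    have -> : al (mid' p) = (val p).1 by rewrite -[in RHS](mK p).
    by rewrite e1 eqxx => -[].
  exists x; apply: val_inj; rewrite /= xa xc.
  by rewrite -[in RHS](mK p) -xd.
exact: composite_mid_bij.
Qed.
End Composite.
End GSets.

(** * Calculus of restrictions, transfers and norms *)

Section Calculus.
Variables (gT : finGroupType) (I : indexing gT) (F : bifunctor I).
Implicit Types X Y Z W V S : gset gT.

Lemma stab_inl X Y (x : X) : stab (inl x : hsum X Y) = stab x.
Proof. by apply/group_inj/setP=> a; rewrite !stabP hsum_actE. Qed.
Lemma stab_inr X Y (y : Y) : stab (inr y : hsum X Y) = stab y.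
Proof. by apply/group_inj/setP=> a; rewrite !stabP hsum_actE. Qed.

(** Multiplication uses norms along maps that preserve stabilizers; their fibres
    have trivial orbits, which every indexing system contains. *)
Lemma unramified_adm X Y (f : hmap X Y) :
  (forall x, stab (f x) \subset stab x) -> badm I (Nb f).
Proof.
move=> fS x; suff <- : stab (f x) = stab x by exact: ix_quo_refl.
by apply/group_inj/eqP; rewrite eqEsubset fS stab_map.
Qed.

Definition tnrm X Y (f : hmap X Y) (h : badm I (Nb f)) : F X -> F Y := tmor h.

Lemma tmor_seq X Y Z (w1 : bispan X Y) (w2 : bispan Y Z) (w3 : bispan X Z)
    (h1 : badm I w1) (h2 : badm I w2) (h3 : badm I w3) (x : F X) :
  biso w3 (bcomp w1 w2) -> tmor h2 (tmor h1 x) = tmor h3 x.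
Proof.
move=> i; rewrite (tmor_iso h3 (bcomp_adm h1 h2) i).
by rewrite (tmor_comp h1 h2).
Qed.

Lemma bispan_ext X Y A B (r r' : hmap A X) (n n' : hmap A B) (t t' : hmap B Y) :
  r =1 r' -> n =1 n' -> t =1 t' -> biso (Bispan r n t) (Bispan r' n' t').
Proof.
move=> er en et; exists (hid A), (hid B); split; try by exists id.
- by move=> x /=.
- by move=> x /=.
- by move=> x /=.
Qed.

Lemma tres_ext X Y (f g : hmap X Y) : f =1 g -> tres (F := F) f =1 tres g.
Proof. by move=> e; apply/tmor_iso/bispan_ext. Qed.
Lemma ttr_ext X Y (f g : hmap X Y) : f =1 g -> ttr (F := F) f =1 ttr g.
Proof. by move=> e; apply/tmor_iso/bispan_ext. Qed.
Lemma tnrm_ext X Y (f g : hmap X Y) (hf : badm I (Nb f)) (hg : badm I (Nb g)) :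
  f =1 g -> tnrm hf =1 tnrm hg.
Proof. by move=> e; apply/tmor_iso/bispan_ext. Qed.

Lemma tres_id X (x : F X) : tres (hid X) x = x.
Proof. exact: tmor_id. Qed.
Lemma ttr_id X (x : F X) : ttr (hid X) x = x.
Proof. exact: (tmor_id (b := F) (Tb_adm I (hid X))). Qed.
Lemma tnrm_id X (h : badm I (Nb (hid X))) (x : F X) : tnrm h x = x.
Proof. exact: (tmor_id (b := F) h). Qed.

Lemma tres_comp X Y Z (f : hmap X Y) (g : hmap Y Z) (x : F Z) :
  tres f (tres g x) = tres (hcomp g f) x.
Proof.
apply: tmor_seq.
apply: (@bcomp_biso _ _ _ _ (Rb g) (Rb f) (Rb (hcomp g f)) id (fun _ => f) f id)
  => //=; try by move=> *; rewrite ?hmapG.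
- by move=> d0 s sP; exists d0 => // c ->; have [b -> <-] := sP d0 erefl.
- by move=> a c d -> <-; exists d.
Qed.

Lemma ttr_comp X Y Z (f : hmap X Y) (g : hmap Y Z) (x : F X) :
  ttr g (ttr f x) = ttr (hcomp g f) x.
Proof.
apply: tmor_seq.
apply: (@bcomp_biso _ _ _ _ (Tb f) (Tb g) (Tb (hcomp g f)) f (fun d _ => d) id f)
  => //=; try by move=> *; rewrite ?hmapG.
- by move=> d d' _ /(_ _ erefl).
- move=> d0 s sP; have [b sb e] := sP d0 erefl.
  by exists b => // c ->.
- by move=> a c d -> <-; exists d.
Qed.

Lemma tnrm_comp X Y Z (f : hmap X Y) (g : hmap Y Z) (hf : badm I (Nb f))
    (hg : badm I (Nb g)) (hgf : badm I (Nb (hcomp g f))) (x : F X) :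
  tnrm hg (tnrm hf x) = tnrm hgf x.
Proof.
apply: tmor_seq.
apply: (@bcomp_biso _ _ _ _ (Nb f) (Nb g) (Nb (hcomp g f)) id (fun _ c => c) id f)
  => //=; try by move=> *; rewrite ?hmapG.
- by move=> d0 s sP; exists d0 => // c /sP[b -> ->].
- by move=> a c d <- ->; exists a.
Qed.

Lemma tmor_adm_nrm X Y (w : bispan X Y) : badm I w -> badm I (Nb (bnrm w)).
Proof. by []. Qed.

Lemma tmorE X Y (w : bispan X Y) (h : badm I w) (x : F X) :
  tmor h x = ttr (btr w) (tnrm (tmor_adm_nrm h) (tres (bres w) x)).
Proof.
have h' : badm I (Bispan (bres w) (bnrm w) (hid (bmid w))) by exact: h.
have -> : tnrm (tmor_adm_nrm h) (tres (bres w) x) = tmor h' x.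
  apply: tmor_seq.
  apply: (@bcomp_biso _ _ _ _ (Rb (bres w)) (Nb (bnrm w))
    (Bispan (bres w) (bnrm w) (hid (bmid w))) id (fun _ c => c) id id) => //=.
  - by move=> d0 s sP; exists d0 => // c /sP[b -> ->].
  - by move=> a c d <- ->; exists a.
apply/esym/tmor_seq.
apply: (@bcomp_biso _ _ _ _ (Bispan (bres w) (bnrm w) (hid (bmid w))) (Tb (btr w))
    w id (fun _ c => c) id (bnrm w)) => //=; try by move=> *; rewrite ?hmapG.
- by move=> d0 s sP; exists d0 => // c /sP[b -> ->].
- by move=> a c d -> ->; exists a.
Qed.

(** Base change (the double coset formulas for transfers and norms). *)
Lemma tres_ttr V X W Y (p : hmap V X) (q : hmap V W) (f : hmap X Y)
    (g : hmap W Y) (x : F X) : is_pullback p q f g ->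
  tres g (ttr f x) = ttr q (tres p x).
Proof.
case=> c ex inj.
have h : badm I (Bispan p (hid V) q) by move=> v; exact: ix_quo_refl.
have -> : ttr q (tres p x) = tmor h x by rewrite tmorE tnrm_id.
apply: tmor_seq.
apply: (@bcomp_biso _ _ _ _ (Tb f) (Rb g) (Bispan p (hid V) q) q (fun d _ => p d) p q)
  => //=; try by move=> *; rewrite ?hmapG.
- by move=> d w ->; exact: c.
- by move=> d d' e /(_ _ erefl) e'; apply: inj.
- move=> d0 s sP; have [b sb e] := sP d0 erefl; have [v vb vd] := ex _ _ e.
  by exists v => // w ->; rewrite vb.
- by move=> a w d -> <-; exists d.
Qed.

Lemma tres_tnrm V X W Y (p : hmap V X) (q : hmap V W) (f : hmap X Y)
    (g : hmap W Y) (hf : badm I (Nb f)) (hq : badm I (Nb q)) (x : F X) :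
  is_pullback p q f g -> tres g (tnrm hf x) = tnrm hq (tres p x).
Proof.
case=> c ex inj.
have h : badm I (Bispan p q (hid W)) by [].
have -> : tnrm hq (tres p x) = tmor h x.
  by rewrite tmorE ttr_id; apply: tnrm_ext.
apply: tmor_seq.
apply: (@bcomp_biso _ _ _ _ (Nb f) (Rb g) (Bispan p q (hid W)) id (fun _ => g) p q)
  => //=; try by move=> *; rewrite ?hmapG.
- by move=> d0 s sP; exists d0 => // w /sP[b -> ->].
- by move=> u v ep eq _; apply: inj.
- move=> a w d -> e; have [v va vw] := ex _ _ (esym e).
  by exists v.
Qed.

(** The exponential diagram for a fold map: over [y] a section picks a point of
    the fibre of [f] in the first summand and [y] itself in the second. *)
Lemma tnrm_fold_ttr X Y (f : hmap X Y) (z : F (hsum X Y)) :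
  tnrm (fold_adm I Y) (ttr (summap f (hid Y)) z)
  = ttr f (tnrm (fold_adm I X) (tres (summap (hid X) f) z)).
Proof.
have h : badm I (Bispan (summap (hid X) f) (hfold X) f) by exact: fold_adm.
have -> : ttr f (tnrm (fold_adm I X) (tres (summap (hid X) f) z)) = tmor h z.
  by rewrite tmorE; congr ttr; apply: tnrm_ext.
apply: tmor_seq.
pose sec (x : X) (u : hsum Y Y) : hsum X Y :=
  match u with inl _ => inl x | inr _ => inr (f x) end.
pose ga (u : hsum X X) : hsum Y Y :=
  match u with inl x => inl (f x) | inr x => inr (f x) end.
apply: (@bcomp_biso _ _ _ _ (Tb (summap f (hid Y))) (Nb (hfold Y))
  (Bispan (summap (hid X) f) (hfold X) f) f sec (summap (hid X) f) ga).
- by move=> d g; rewrite hmapG.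
- move=> d c g _; rewrite /sec !hsum_actE.
  by case: c => y //=; rewrite hmapG.
- by move=> d g; rewrite hmapG.
- by move=> c g; rewrite /ga !hsum_actE; case: c => y //=; rewrite hmapG.
- by [].
- by move=> d [] y /= ->.
- by move=> d d' e /(_ (inl (f d)) erefl) [].
- move=> d0 s sP; have [[x sx /= [e]|x sx //]] := sP (inl d0) erefl.
  exists x => // -[y /= -> //|y /= ->].
  by have [[x' -> //|x' -> /= [->]]] := sP (inr d0) erefl; rewrite e.
- by case.
- by case.
- by case.
- by case=> x [] x' //= _ _ ->.
- move=> a c d /= e; case: c e => y /= -> => [<-|<-].
    by exists (inl d).
  by exists (inr d).
Qed.

(** * Values on disjoint unions *)

Lemma tpair_ext X Y (u v : F (hsum X Y)) :
  tres (hinl X Y) u = tres (hinl X Y) v ->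
  tres (hinr X Y) u = tres (hinr X Y) v -> u = v.
Proof.
by move=> el er; rewrite -(tpair_eta u) -(tpair_eta v); congr tpair.
Qed.

Lemma tres_inl X Y (x : F X) (y : F Y) : tres (hinl X Y) (tpair x y) = x.
Proof. exact: tpairl. Qed.
Lemma tres_inr X Y (x : F X) (y : F Y) : tres (hinr X Y) (tpair x y) = y.
Proof. exact: tpairr. Qed.

Lemma tres_pair X Y X' Y' (f : hmap X X') (g : hmap Y Y') (x : F X') (y : F Y') :
  tres (summap f g) (tpair x y) = tpair (tres f x) (tres g y).
Proof.
apply: tpair_ext; rewrite tres_comp ?tres_inl ?tres_inr.
  by rewrite -[in RHS](tres_inl x y) tres_comp; apply: tres_ext.
by rewrite -[in RHS](tres_inr x y) tres_comp; apply: tres_ext.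
Qed.

Lemma summap_pull_l X Y X' Y' (f : hmap X X') (g : hmap Y Y') :
  is_pullback (hinl X Y) f (summap f g) (hinl X' Y').
Proof.
split=> //= [[x|y] w //= [e]|v v' [->] //].
by exists x.
Qed.
Lemma summap_pull_r X Y X' Y' (f : hmap X X') (g : hmap Y Y') :
  is_pullback (hinr X Y) g (summap f g) (hinr X' Y').
Proof.
split=> //= [[x|y] w //= [e]|v v' [->] //].
by exists y.
Qed.

Lemma ttr_pair X Y X' Y' (f : hmap X X') (g : hmap Y Y') (x : F X) (y : F Y) :
  ttr (summap f g) (tpair x y) = tpair (ttr f x) (ttr g y).
Proof.
apply: tpair_ext; rewrite ?tres_inl ?tres_inr.
  by rewrite (tres_ttr _ (summap_pull_l f g)) tres_inl.
by rewrite (tres_ttr _ (summap_pull_r f g)) tres_inr.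
Qed.

Lemma tnrm_pair X Y X' Y' (f : hmap X X') (g : hmap Y Y') (hf : badm I (Nb f))
    (hg : badm I (Nb g)) (hfg : badm I (Nb (summap f g))) (x : F X) (y : F Y) :
  tnrm hfg (tpair x y) = tpair (tnrm hf x) (tnrm hg y).
Proof.
apply: tpair_ext; rewrite ?tres_inl ?tres_inr.
  by rewrite (tres_tnrm _ hf _ (summap_pull_l f g)) tres_inl.
by rewrite (tres_tnrm _ hg _ (summap_pull_r f g)) tres_inr.
Qed.

Lemma sum_adm X Y X' Y' (f : hmap X X') (g : hmap Y Y') :
  badm I (Nb f) -> badm I (Nb g) -> badm I (Nb (summap f g)).
Proof.
by move=> hf hg [x|y] /=; rewrite ?stab_inl ?stab_inr; [exact: hf|exact: hg].
Qed.

Lemma pull_iso X Y (f : hmap X Y) : bijective f ->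
  is_pullback f f (hid Y) (hid Y).
Proof.
case=> g fK gK; split=> //= [y w <-|v v' _ /(can_inj fK) //].
by exists (g y).
Qed.

Lemma ttr_iso X Y (f : hmap X Y) (x : F Y) :
  bijective f -> ttr f (tres f x) = x.
Proof. by move/pull_iso/tres_ttr=> <-; rewrite tres_id ttr_id. Qed.

Lemma tnrm_iso X Y (f : hmap X Y) (h : badm I (Nb f)) (x : F Y) :
  bijective f -> tnrm h (tres f x) = x.
Proof.
have hid_adm : badm I (Nb (hid Y)) by apply: unramified_adm.
by move/pull_iso/(tres_tnrm hid_adm h)=> <-; rewrite tres_id tnrm_id.
Qed.

Lemma tres_ttr_iso X Y (f : hmap X Y) (x : F X) :
  bijective f -> tres f (ttr f x) = x.
Proof.
move=> /bij_inj fI; rewrite -[RHS]ttr_id -[in RHS](tres_id x).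
by apply: tres_ttr; split=> //= [y w /fI ->]; exists w.
Qed.

Lemma iso_adm X Y (f : hmap X Y) : injective f -> badm I (Nb f).
Proof.
move=> fI; apply: unramified_adm => x; apply/subsetP=> g.
by rewrite !stabP -hmapG (inj_eq fI).
Qed.

Lemma tpt_unique (x y : F (hempty gT)) : x = y.
Proof. by rewrite (tptP x) (tptP y). Qed.

(** * The ring structure *)

Lemma tmulE X (x y : F X) : tmul x y = tnrm (fold_adm I X) (tpair x y).
Proof. by []. Qed.
Lemma toneE X : tone = tnrm (empty_adm I X) (tpt F).
Proof. by []. Qed.

(** A fold map is the pullback of a fold map along any map, so restrictions commute
    with sums and products by base change. *)
Lemma fold_pull X Y (f : hmap X Y) : is_pullback (summap f f) (hfold X) (hfold Y) f.
Proof.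
split=> [[] //|[y|y] w /= ->|[v|v] [v'|v'] //= _ ->] //.
  by exists (inl w).
by exists (inr w).
Qed.

Lemma tres_add X Y (f : hmap X Y) (x y : F Y) :
  tres f (tadd x y) = tadd (tres f x) (tres f y).
Proof. by rewrite /tadd (tres_ttr _ (fold_pull f)) tres_pair. Qed.

Lemma tres_mul X Y (f : hmap X Y) (x y : F Y) :
  tres f (tmul x y) = tmul (tres f x) (tres f y).
Proof.
rewrite !tmulE (tres_tnrm _ (fold_adm I X) _ (fold_pull f)).
by rewrite tres_pair.
Qed.

Lemma empty_pull X Y (f : hmap X Y) :
  is_pullback (hid (hempty gT)) (from_empty X) (from_empty Y) f.
Proof. by split; case. Qed.

Lemma tres_zero X Y (f : hmap X Y) : tres f (tzero : F Y) = tzero.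
Proof. by rewrite /tzero (tres_ttr _ (empty_pull f)) tres_id. Qed.

Lemma tres_one X Y (f : hmap X Y) : tres f (tone : F Y) = tone.
Proof.
by rewrite !toneE (tres_tnrm _ (empty_adm I X) _ (empty_pull f)) tres_id.
Qed.

Lemma ttr_add X Y (f : hmap X Y) (x y : F X) :
  ttr f (tadd x y) = tadd (ttr f x) (ttr f y).
Proof.
rewrite /tadd -ttr_pair !ttr_comp; apply: ttr_ext; by case.
Qed.

Lemma ttr_zero X Y (f : hmap X Y) : ttr f (tzero : F X) = tzero.
Proof. by rewrite /tzero ttr_comp; apply: ttr_ext; case. Qed.

Lemma tnrm_mul X Y (f : hmap X Y) (h : badm I (Nb f)) (x y : F X) :
  tnrm h (tmul x y) = tmul (tnrm h x) (tnrm h y).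
Proof.
have h2 := sum_adm h h; rewrite !tmulE -(tnrm_pair h h h2).
have ha : badm I (Nb (hcomp (hfold Y) (summap f f))).
  by move=> [u|u] /=; rewrite ?stab_inl ?stab_inr; apply: h.
have hb : badm I (Nb (hcomp f (hfold X))).
  by move=> [u|u] /=; rewrite ?stab_inl ?stab_inr; apply: h.
rewrite (tnrm_comp _ _ ha) (tnrm_comp _ _ hb).
by apply: tnrm_ext; case.
Qed.

Lemma tnrm_one X Y (f : hmap X Y) (h : badm I (Nb f)) :
  tnrm h (tone : F X) = tone.
Proof.
have h0 : badm I (Nb (hcomp f (from_empty X))) by case.
by rewrite !toneE (tnrm_comp _ _ h0); apply: tnrm_ext; case.
Qed.

(** The product with [y] is a norm along a fold map of a transfer along [f] on one
    summand, so the exponential diagram above moves [y] under the transfer. *)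
Lemma frobenius X Y (f : hmap X Y) (x : F X) (y : F Y) :
  tmul (ttr f x) y = ttr f (tmul x (tres f y)).
Proof.
rewrite tmulE -[y in tpair _ y]ttr_id -ttr_pair tnrm_fold_ttr.
by rewrite tres_pair tres_id.
Qed.

Definition swap_fun X Y (u : hsum X Y) : hsum Y X :=
  match u with inl x => inr x | inr y => inl y end.
Lemma swap_subproof X Y (u : hsum X Y) g :
  swap_fun (hact (hsum X Y) u g) = hact (hsum Y X) (swap_fun u) g.
Proof. by rewrite !hsum_actE; case: u. Qed.
Definition swap X Y : hmap (hsum X Y) (hsum Y X) := gmap (@swap_subproof X Y).
Lemma swap_bij X Y : bijective (swap X Y).
Proof. by exists (swap Y X); case. Qed.

Lemma tmulC X (x y : F X) : tmul x y = tmul y x.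
Proof.
have e : tpair y x = tres (swap X X) (tpair x y) :> F (hsum X X).
  apply: tpair_ext; rewrite tres_comp ?tres_inl ?tres_inr.
    by rewrite -[LHS](tres_inr x y); apply: tres_ext.
  by rewrite -[LHS](tres_inl x y); apply: tres_ext.
rewrite !tmulE e -{1}(tnrm_iso (iso_adm (bij_inj (swap_bij X X)))
  (tpair x y) (swap_bij X X)).
have h : badm I (Nb (hcomp (hfold X) (swap X X))).
  by move=> [u|u]; rewrite /= ?stab_inl ?stab_inr; apply: ix_quo_refl.
by rewrite (tnrm_comp _ _ h); apply: tnrm_ext; case.
Qed.

Definition assoc_fun X Y Z (u : hsum (hsum X Y) Z) : hsum X (hsum Y Z) :=
  match u with
  | inl (inl x) => inl x | inl (inr y) => inr (inl y) | inr z => inr (inr z)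
  end.
Lemma assoc_subproof X Y Z (u : hsum (hsum X Y) Z) g :
  assoc_fun (hact (hsum (hsum X Y) Z) u g)
  = hact (hsum X (hsum Y Z)) (assoc_fun u) g.
Proof.
by rewrite !hsum_actE; case: u => [[x|y]|z]; rewrite /assoc_fun /hsum_op ?hsum_actE.
Qed.
Definition assoc X Y Z : hmap (hsum (hsum X Y) Z) (hsum X (hsum Y Z)) :=
  gmap (@assoc_subproof X Y Z).
Lemma assoc_bij X Y Z : bijective (assoc X Y Z).
Proof.
exists (fun u => match u with inl x => inl (inl x) | inr (inl y) => inl (inr y)
                 | inr (inr z) => inr z end); first by case=> [[]|].
by case=> [|[]].
Qed.

Lemma tres_assoc X Y Z (x : F X) (y : F Y) (z : F Z) :
  tres (assoc X Y Z) (tpair x (tpair y z)) = tpair (tpair x y) z.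
Proof.
apply: tpair_ext; rewrite tres_comp ?tres_inl ?tres_inr.
  apply: tpair_ext; rewrite tres_comp ?tres_inl ?tres_inr.
    by rewrite -[RHS](tres_inl x (tpair y z)); apply: tres_ext.
  rewrite -[RHS](tres_inl y z) -[tpair y z in RHS](tres_inr x) tres_comp.
  exact: tres_ext.
rewrite -[RHS](tres_inr y z) -[tpair y z in RHS](tres_inr x) tres_comp.
exact: tres_ext.
Qed.

Lemma stab_fold X (u : hsum X X) : stab (fold_fun u) \subset stab u.
Proof. by case: u => x; rewrite ?stab_inl ?stab_inr. Qed.

Lemma stab_sum X Y X' Y' (f : hmap X X') (g : hmap Y Y') (u : hsum X Y) :
  (forall x, stab (f x) \subset stab x) ->
  (forall y, stab (g y) \subset stab y) ->
  stab (summap f g u) \subset stab u.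
Proof.
move=> fS gS; apply/subsetP=> a; rewrite !stabP !hsum_actE.
case: u => x /= /eqP[e]; apply/eqP; congr (_ _); apply/eqP.
  by rewrite -stabP; apply: (subsetP (fS x)); rewrite stabP e.
by rewrite -stabP; apply: (subsetP (gS x)); rewrite stabP e.
Qed.

(** Both triple products are norms from three copies of [X], along the two
    bracketings of the fold map. *)
Lemma tmulA X (x y z : F X) : tmul x (tmul y z) = tmul (tmul x y) z.
Proof.
have fS := @stab_fold X; have idS (u : X) := subxx (stab u).
have hi : badm I (Nb (hid X)) by apply: unramified_adm.
have h1 : badm I (Nb (summap (hid X) (hfold X))) by apply: sum_adm hi (fold_adm I X).
have h2 : badm I (Nb (summap (hfold X) (hid X))) by apply: sum_adm (fold_adm I X) hi.
have h3 : badm I (Nb (hcomp (hfold X) (summap (hid X) (hfold X)))).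
  by apply: unramified_adm => u; apply: subset_trans (stab_fold _) (stab_sum _ _ _).
have h4 : badm I (Nb (hcomp (hfold X) (summap (hfold X) (hid X)))).
  by apply: unramified_adm => u; apply: subset_trans (stab_fold _) (stab_sum _ _ _).
have aB := assoc_bij X X X; have ha := iso_adm (bij_inj aB).
rewrite !tmulE -[x in tpair x (tnrm _ _)](tnrm_id hi) -(tnrm_pair hi _ h1).
rewrite -[z in RHS](tnrm_id hi) -(tnrm_pair _ hi h2).
rewrite (tnrm_comp _ _ h3) (tnrm_comp _ _ h4) -tres_assoc.
rewrite -[tpair x _ in LHS](tnrm_iso ha _ aB).
have h5 : badm I (Nb (hcomp (hcomp (hfold X) (summap (hid X) (hfold X))) (assoc X X X))).
  apply: unramified_adm => u; apply: subset_trans (_ : stab (assoc X X X u) \subset _).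
    by apply: subset_trans (stab_fold _) (stab_sum _ _ _).
  apply/subsetP=> g; rewrite !stabP -hmapG.
  by rewrite (inj_eq (bij_inj aB)).
by rewrite (tnrm_comp _ _ h5); apply: tnrm_ext => -[[]|].
Qed.

Lemma tmul1 X (x : F X) : tmul x tone = x.
Proof.
have hi : badm I (Nb (hid X)) by apply: unramified_adm.
pose s := summap (hid X) (from_empty X); pose f := hcomp (hfold X) s.
have hs : badm I (Nb s) by apply: sum_adm hi (empty_adm I X).
have fB : bijective f by exists (hinl X (hempty gT)) => //; case=> // -[].
have hf := iso_adm (bij_inj fB).
rewrite tmulE toneE -{1}(tnrm_id hi x) -(tnrm_pair _ _ hs).
rewrite (tnrm_comp _ _ hf) -[RHS](tnrm_iso hf _ fB); congr tnrm.
apply: tpair_ext; last exact: tpt_unique.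
by rewrite tres_inl tres_comp -[LHS]tres_id; apply: tres_ext.
Qed.

Lemma tmul0 X (x : F X) : tmul tzero x = tzero.
Proof. by rewrite /tzero frobenius; congr ttr; apply: tpt_unique. Qed.

(** A sum is a transfer along a fold map: distributivity is Frobenius
    reciprocity for it. *)
Lemma tmulDl X (x y z : F X) : tmul (tadd x y) z = tadd (tmul x z) (tmul y z).
Proof.
rewrite /tadd frobenius; congr ttr.
apply: tpair_ext; rewrite tres_mul ?tres_inl ?tres_inr tres_comp.
  by congr tmul; rewrite -[RHS]tres_id; apply: tres_ext.
by congr tmul; rewrite -[RHS]tres_id; apply: tres_ext.
Qed.

(** * Decompositions of the base *)
Section Decomposition.
Variables (Y Y1 Y2 : gset gT) (i1 : hmap Y1 Y) (i2 : hmap Y2 Y).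
Hypothesis iB : bijective (copair i1 i2).

Lemma tres_copair (a : F Y) : tres (copair i1 i2) a = tpair (tres i1 a) (tres i2 a).
Proof.
by apply: tpair_ext; rewrite ?tres_inl ?tres_inr tres_comp; apply: tres_ext.
Qed.

Lemma decomp_ext (a b : F Y) :
  tres i1 a = tres i1 b -> tres i2 a = tres i2 b -> a = b.
Proof.
by move=> e1 e2; rewrite -(ttr_iso a iB) -(ttr_iso b iB) !tres_copair e1 e2.
Qed.

Lemma decomp_ex (a1 : F Y1) (a2 : F Y2) :
  exists2 a : F Y, tres i1 a = a1 & tres i2 a = a2.
Proof.
exists (ttr (copair i1 i2) (tpair a1 a2)).
  rewrite -[RHS](tres_inl a1 a2) -[in RHS](tres_ttr_iso (tpair a1 a2) iB).
  by rewrite [RHS]tres_comp; apply: tres_ext.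
rewrite -[RHS](tres_inr a1 a2) -[in RHS](tres_ttr_iso (tpair a1 a2) iB).
by rewrite [RHS]tres_comp; apply: tres_ext.
Qed.

Lemma decomp_ttr (a : F Y) : a = tadd (ttr i1 (tres i1 a)) (ttr i2 (tres i2 a)).
Proof.
rewrite -{1}(ttr_iso a iB) tres_copair /tadd -ttr_pair ttr_comp.
by apply: ttr_ext; case.
Qed.

Lemma decomp_tnrm Z (f : hmap Y Z) (h : badm I (Nb f))
    (h1 : badm I (Nb (hcomp f i1))) (h2 : badm I (Nb (hcomp f i2))) (a : F Y) :
  tnrm h a = tmul (tnrm h1 (tres i1 a)) (tnrm h2 (tres i2 a)).
Proof.
have hi := iso_adm (bij_inj iB).
rewrite -{1}(tnrm_iso hi a iB) tres_copair tmulE -(tnrm_pair _ _ (sum_adm h1 h2)).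
have h3 : badm I (Nb (hcomp f (copair i1 i2))).
  by move=> [u|u] /=; rewrite ?stab_inl ?stab_inr; [exact: h1|exact: h2].
have h4 : badm I (Nb (hcomp (hfold Z) (summap (hcomp f i1) (hcomp f i2)))).
  by move=> [u|u] /=; rewrite ?stab_inl ?stab_inr; [exact: h1|exact: h2].
by rewrite (tnrm_comp _ _ h3) (tnrm_comp _ _ h4); apply: tnrm_ext; case.
Qed.
End Decomposition.

End Calculus.

(** * The solvable residual *)

Section Residual.
Variables (gT : finGroupType) (P : nat_pred).
Implicit Types L Q M N : {group gT}.

Lemma solv_res_predJ Q N g :
  solv_res_pred P Q N -> solv_res_pred P (Q :^ g)%G (N :^ g)%G.
Proof.
case/and3P=> nN sN pN; have n2 : N :^ g <| Q :^ g by rewrite normalJ.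
have sNQ := normal_sub nN.
have im M : M \subset Q -> conjgm Q g @* M = M :^ g.
  by move=> sMQ; rewrite morphim_conj (setIidPr sMQ).
pose q := quotm_morphism (conjgm_morphism Q g) nN.
have := morphim_pgroup q pN; have := morphim_sol q sN.
rewrite !morphim_quotm !im // => sNg pNg.
by apply/and3P; split.
Qed.

Lemma solv_resJ Q g : solv_res P (Q :^ g)%G = (solv_res P Q :^ g)%G.
Proof.
have [QP Qmin] := solv_resP P Q; have [QgP Qgmin] := solv_resP P (Q :^ g)%G.
apply/group_inj/eqP; rewrite eqEsubset Qgmin ?solv_res_predJ //=.
have QgV : solv_res_pred P Q (conjG_group (solv_res P (Q :^ g)%G) g^-1).
  have := solv_res_predJ g^-1 QgP; rewrite (_ : conjG_group _ _ = Q) //.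
  by apply/group_inj; rewrite /= conjsgK.
by rewrite sub_conjg; apply: Qmin QgV.
Qed.

Lemma solv_res_sub Q : solv_res P Q \subset Q.
Proof. by have [/and3P[/normal_sub]] := solv_resP P Q. Qed.

(** The quotient [M / (M :&: K)] embeds in [Q / K]. *)
Lemma solv_res_predS Q M K : M \subset Q -> solv_res_pred P Q K ->
  solv_res_pred P M (M :&: K)%G.
Proof.
move=> sMQ /and3P[nK sK pK].
have nMK : M \subset 'N(K) := subset_trans sMQ (normal_norm nK).
have n2 : M :&: K <| M by rewrite /normal subsetIl normsI ?normG.
have iso : M / (M :&: K) \isog M / K.
  by rewrite setIC; exact: second_isog.
apply/and3P; split=> //=.
  by rewrite (isog_sol iso); apply: solvableS sK; rewrite quotientS.
by rewrite (isog_pgroup _ iso); apply: pgroupS pK; rewrite quotientS.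
Qed.

(** A group that is its own residual lies in the residual of every group that
    contains it. *)
Lemma solv_res_between Q M : solv_res P (solv_res P Q) = solv_res P Q ->
  solv_res P Q \subset M -> M \subset Q -> solv_res P M = solv_res P Q.
Proof.
move=> NN sNM sMQ; have [QP _] := solv_resP P Q; have [MP Mmin] := solv_resP P M.
apply/group_inj/eqP; rewrite eqEsubset; apply/andP; split.
  rewrite (subset_trans (Mmin _ (solv_res_predS sMQ QP))) //; exact: subsetIr.
have [_ Nmin] := solv_resP P (solv_res P Q).
have := Nmin _ (solv_res_predS sNM MP); rewrite NN => s.
exact: subset_trans s (subsetIr _ _).
Qed.
End Residual.

(** * Admissible sets form an indexing system *)

Section OrbitMap.
Variables (gT : finGroupType) (H K : {group gT}) (S : hset H) (x : S).
Hypothesis sKx : K \subset 'C_H[x | hact S].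

Definition orbit_fun (C : hquo H K) : S := hact S x (repr (val C)).

Lemma orbit_funE h (hH : h \in H) : orbit_fun (quo_pt K hH) = hact S x h.
Proof.
rewrite /orbit_fun /=; have /rcosetP[k kK ->] := mem_repr_rcoset K h.
by have := subsetP sKx _ kK; rewrite capP => /andP[kH /eqP xk]; rewrite hactM // xk.
Qed.

Lemma orbit_subproof (C : hquo H K) : {in H, forall a,
  orbit_fun (hact (hquo H K) C a) = hact S (orbit_fun C) a}.
Proof.
move=> a aH; have [h [hH ->]] := quo_ptP C.
by rewrite quo_ptM !orbit_funE hactM.
Qed.
Definition orbit_map : hmap (hquo H K) S := HMap orbit_subproof.

Lemma orbit_mapE h (hH : h \in H) : orbit_map (quo_pt K hH) = hact S x h.
Proof. exact: orbit_funE. Qed.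
End OrbitMap.

Section Admissible.
Variables (gT : finGroupType) (L : {group gT}).
Implicit Types H K : {group gT}.

Lemma ind_class_move K (T : hset K) (t : T) k h :
  k \in K -> ind_class t (k * h) = ind_class (hact T t k) h.
Proof.
move=> kK; apply/setP=> u; apply/imsetP/imsetP=> -[k' k'K ->].
  exists (k^-1 * k'); first by rewrite groupM ?groupV.
  by rewrite -hactM ?groupM ?groupV // mulKVg invMg invgK mulgA.
exists (k * k'); first by rewrite groupM.
by rewrite hactM // invMg mulgA mulgKV.
Qed.

(** Two maps from an orbit into a limit agree as soon as their projections do, so
    the projections of a point determine which group elements fix it. *)
Lemma limit_stab H (D : diagram H) (S : hset H) (p : forall i, hmap S (D i)) (x : S) h :
  is_limit p -> h \in H -> (forall i, hact (D i) (p i x) h = p i x) ->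
  hact S x h = x.
Proof.
move=> [pC pU] hH ph.
(* [M] fixes all projections of [x]; the map from [H/M] into the limit yields a
   point [y], fixed by [M], with the projections of [x]. *)
pose M : {group gT} := (H :&: \bigcap_i 'C_H[p i x | hact (D i)])%G.
have MP m : (m \in M) = (m \in H) && [forall i, hact (D i) (p i x) m == p i x].
  rewrite in_setI; case mH: (m \in H) => //=.
  apply/bigcapP/forallP=> [mP i|mP i _]; last by rewrite capP mH mP.
  by have := mP i isT; rewrite capP mH.
have sM i : M \subset 'C_H[p i x | hact (D i)].
  by apply/subsetP=> m; rewrite MP capP => /andP[-> /forallP->].
pose N : {group gT} := 'C_H[x | hact S]%G.
have [u [uE _]] : exists u : hmap (hquo H M) S,
    (forall i y, p i (u y) = orbit_map (sM i) y) /\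
    forall v : hmap (hquo H M) S,
      (forall i y, p i (v y) = orbit_map (sM i) y) -> v =1 u.
  apply: pU => j C; have [a [aH ->]] := quo_ptP C.
  by rewrite !orbit_mapE hmapP // pC.
pose y := u (quo_pt M (group1 H)).
have py i : p i y = p i x by rewrite uE orbit_mapE hact1.
have yM m : m \in M -> hact S y m = y.
  move=> mM; have mH : m \in H by move: mM; rewrite MP => /andP[].
  rewrite /y -hmapP // quo_ptM; congr (u _); apply/eqP.
  by rewrite quo_pt_eq invg1 mulg1 mul1g.
(* The stabilizer [N] of [x] lies in [M], so [x] and [y] both give maps from
   [H/N]; these agree after projection. *)
have sNM : N \subset M.
  apply/subsetP=> n; rewrite capP MP => /andP[nH /eqP xn]; rewrite nH.
  by apply/forallP=> i; rewrite -hmapP // xn.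
have sNy : N \subset 'C_H[y | hact S].
  apply/subsetP=> n nN; rewrite capP (yM n) ?(subsetP sNM) // eqxx andbT.
  by move: nN; rewrite capP => /andP[].
have sNx : N \subset 'C_H[x | hact S] by [].
have [w [_ wU]] : exists w : hmap (hquo H N) S,
    (forall i z, p i (w z) = p i (orbit_map sNx z)) /\
    forall v : hmap (hquo H N) S,
      (forall i z, p i (v z) = p i (orbit_map sNx z)) -> v =1 w.
  have qP i z : {in H, forall a, p i (orbit_map sNx (hact (hquo H N) z a))
      = hact (D i) (p i (orbit_map sNx z)) a}.
    by move=> a aH; rewrite (hmapP (orbit_map sNx) z aH); exact: hmapP.
  exact: (pU _ (fun i => HMap (qP i)) (fun j z => pC _ _)).
have e1 := wU (orbit_map sNx) (fun i z => erefl) (quo_pt N (group1 H)).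
have e2 := wU (orbit_map sNy) _ (quo_pt N (group1 H)).
have exy : x = y.
  rewrite -[x]hact1 -[y]hact1 -(orbit_mapE sNx (group1 H)).
  rewrite -(orbit_mapE sNy (group1 H)) [LHS]e1 [RHS]e2 // => i C.
  have [a [aH ->]] := quo_ptP C.
  by rewrite !orbit_mapE !hmapP // py.
by rewrite exy yM // MP hH; apply/forallP=> i; rewrite ph.
Qed.

Lemma admissible_axioms : indexing_axioms (@admissible gT L).
Proof.
split.
- move=> H K g sKH S adm x y sLK; apply/subsetP=> k kL.
  have kK := subsetP sLK _ kL.
  rewrite capP kK mk_hsetE // /hpull_op.
  have sLH : L :^ (y * g^-1) \subset H.
    by rewrite conjsgM sub_conjgV (subset_trans sLK).
  have := subsetP (adm x _ sLH) (k ^ g^-1); rewrite conjsgM memJ_conjg kL capP.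
  by move=> /(_ isT)/andP[].
- move=> H T x y sLH; apply/subsetP=> k kL; rewrite capP (subsetP sLH) //.
  by rewrite mk_hsetE ?(subsetP sLH) // /htriv_op eqxx.
- move=> H S T admS admT [] x y sLH; apply/subsetP=> k kL;
    rewrite capP (subsetP sLH) // mk_hsetE ?(subsetP sLH) //.
    by have := subsetP (admS x y sLH) k kL; rewrite capP => /andP[_ /eqP/= ->].
  by have := subsetP (admT x y sLH) k kL; rewrite capP => /andP[_ /eqP/= ->].
- move=> H D S p lim adm x y sLH; apply/subsetP=> k kL.
  have kH := subsetP sLH _ kL; rewrite capP kH /=; apply/eqP.
  apply: limit_stab lim kH _ => i.
  by have := subsetP (adm i (p i x) y sLH) k kL; rewrite capP => /andP[_ /eqP].
- move=> H K T sKH admK admT [C CP] y sLH; apply/subsetP=> l lL.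
  have lH := subsetP sLH _ lL; rewrite capP lH andTb -val_eqE hsubE //.
  rewrite mk_hsetE //=; have /existsP[t /exists_inP[h hH /eqP->]] := CP.
  rewrite ind_op_class.
  have sLH' : L :^ (y * h^-1) \subset H by rewrite conjsgM sub_conjgV (conjGid hH).
  have sLK : L :^ (y * h^-1) \subset K.
    apply/subsetP=> k kL; have kH := subsetP sLH' _ kL.
    have := subsetP (admK (quo_pt K (group1 H)) _ sLH') k kL.
    by rewrite capP kH quo_ptM quo_pt_eq invg1 mulg1 mul1g.
  have lK : l ^ h^-1 \in L :^ (y * h^-1) by rewrite conjsgM memJ_conjg.
  have -> : h * l = l ^ h^-1 * h by rewrite conjgE invgK mulgA mulgKV.
  rewrite ind_class_move ?(subsetP sLK) //.
  by have := subsetP (admT t _ sLK) _ lK; rewrite capP => /andP[_ /eqP->].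
Qed.

End Admissible.

(** * Orbits of finite [G]-sets *)

Section Orbits.
Variable gT : finGroupType.
Implicit Types (X Y Z : gset gT) (K Q : {group gT}).

Definition orb_at K g : orb K := quo_pt K (in_setT g).

Lemma orb_atP K (w : orb K) : exists g, w = orb_at K g.
Proof.
have [g [gG ->]] := quo_ptP w; exists g.
by apply/eqP; rewrite quo_pt_eq mulgV.
Qed.

Lemma orb_at_eq K g h : (orb_at K g == orb_at K h) = (g * h^-1 \in K).
Proof. exact: quo_pt_eq. Qed.

Lemma orb_at_act K g h : hact (orb K) (orb_at K g) h = orb_at K (g * h).
Proof.
by rewrite (quo_ptM _ _ (in_setT h)); apply/eqP; rewrite quo_pt_eq mulgV.
Qed.

Lemma stab_orb_at K g : stab (orb_at K g) = (K :^ g)%G.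
Proof.
apply/group_inj/setP=> h; rewrite stabP orb_at_act orb_at_eq mem_conjg.
by rewrite conjgE invgK mulgA.
Qed.

Lemma orb_map_subproof X K (x : X) :
  K \subset stab x -> K \subset 'C_[set: gT][x | hact X].
Proof. by move=> sKx; rewrite subsetI subsetT. Qed.
Definition orb_map X K (x : X) (sKx : K \subset stab x) : hmap (orb K) X :=
  orbit_map (orb_map_subproof sKx).

Lemma orb_mapE X K (x : X) (sKx : K \subset stab x) g :
  orb_map sKx (orb_at K g) = hact X x g.
Proof. exact: orbit_mapE. Qed.

Lemma orb_map1 X K (x : X) (sKx : K \subset stab x) : orb_map sKx (orb_at K 1) = x.
Proof. by rewrite orb_mapE hact1. Qed.

Lemma orb_map_ext X K (f f' : hmap (orb K) X) :
  f (orb_at K 1) = f' (orb_at K 1) -> f =1 f'.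
Proof.
move=> e w; have [g ->] := orb_atP w.
by rewrite -[g]mul1g -orb_at_act !hmapG e.
Qed.

Section Complement.
Variables (X : gset gT) (x : X).
Definition off_orbit (u : X) : bool := ~~ [exists g, hact X x g == u].
Lemma off_orbit_stable : {in [set: gT]%G, forall a u, off_orbit u ->
  off_orbit (hact X u a)}.
Proof.
move=> a _ u; apply: contra => /existsP[g /eqP e]; apply/existsP.
by exists (g * a^-1); rewrite hactMG e hactK.
Qed.
Definition complement : gset gT := hsub off_orbit_stable.
Definition complement_map : hmap complement X :=
  gmap (fun (u : complement) g => hsub_actE u g).

Lemma orbit_decomposition :
  bijective (copair (orb_map (subxx (stab x))) complement_map).
Proof.
apply: inj_surj_bij => [[u|u] [v|v]|u].
- have [g ->] := orb_atP u; have [h ->] := orb_atP v.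
  rewrite [X in X = _ -> _]orb_mapE [X in _ = X -> _]orb_mapE => e.
  congr inl; apply/eqP; rewrite orb_at_eq stabP hactMG e.
  by rewrite hactK.
- have [g ->] := orb_atP u; rewrite [X in X = _ -> _]orb_mapE => e.
  by have /existsP[] := valP v; exists g; rewrite e.
- have [g ->] := orb_atP v; rewrite [X in _ = X -> _]orb_mapE => e.
  by have /existsP[] := valP u; exists g; rewrite -e.
- by move=> e; congr inr; apply: val_inj.
case: (boolP (off_orbit u)) => [uP|].
  by exists (inr (exist off_orbit u uP : complement)).
rewrite negbK => /existsP[g /eqP <-].
by exists (inl (orb_at (stab x) g)); rewrite [LHS]orb_mapE.
Qed.

Lemma card_complement : #|complement| < #|X|.
Proof.
have [g ik ki] := orbit_decomposition.
have := card_in_image (in2W (bij_inj orbit_decomposition)).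
rewrite -(bij_eq_card orbit_decomposition) card_sum -[X in X < _]add0n ltn_add2r.
by move=> _; apply/card_gt0P; exists (orb_at _ 1).
Qed.
End Complement.

(** Values at a disjoint union are determined by the values at the two parts, so
    statements about orbits extend to all finite sets by removing one orbit at a
    time. *)
Lemma gset_ind (Pr : gset gT -> Prop) :
  (forall X, (X -> False) -> Pr X) ->
  (forall K X Y (i1 : hmap (orb K) X) (i2 : hmap Y X),
     bijective (copair i1 i2) -> Pr Y -> Pr X) ->
  forall X, Pr X.
Proof.
move=> P0 PS X; have [n] := ubnP #|X|; elim: n X => // n IH X leX.
case: (pickP (mem X)) => [x _|X0]; last by apply: P0 => x; have := X0 x.
apply: PS (orbit_decomposition x) (IH _ _).
exact: leq_trans (card_complement x) leX.
Qed.

Lemma bang_subproof X (x : X) g :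
  top_pt gT = hact (orb [set: gT]%G) (top_pt gT) g.
Proof. exact: (to_topP (orb_at [set: gT]%G 1) (in_setT g)). Qed.
Definition bang X : hmap X (orb [set: gT]%G) := gmap (@bang_subproof X).

Lemma orb_top_unique (u v : orb [set: gT]%G) : u = v.
Proof.
have [g ->] := orb_atP u; have [h ->] := orb_atP v.
by apply/eqP; rewrite orb_at_eq inE.
Qed.

Lemma tval_empty (I : indexing gT) (F : bifunctor I) X :
  (X -> False) -> forall a b : F X, a = b.
Proof.
move=> X0 a b.
have eB : bijective (from_empty X) by exists (fun x => match X0 x with end) => x;
  [case: x|case: (X0 x)].
by rewrite -(ttr_iso a eB) -(ttr_iso b eB); congr ttr; apply: tpt_unique.
Qed.
End Orbits.

(** * Multiples and classes *)

Section Multiples.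
Variables (gT : finGroupType) (I : indexing gT) (F : itambara I).
Implicit Types X Y : gset gT.

Lemma tadd_cancel X (x y z : F X) : tadd x z = tadd y z -> x = y.
Proof.
move=> e; have [t zt] := taddN z.
by rewrite -(tadd0 x) -(tadd0 y) -zt !taddA e.
Qed.

Lemma taddAC X (x y z : F X) : tadd (tadd x y) z = tadd (tadd x z) y.
Proof. by rewrite -!taddA (taddC y). Qed.

Lemma taddACA X (x y z t : F X) :
  tadd (tadd x y) (tadd z t) = tadd (tadd x z) (tadd y t).
Proof. by rewrite !taddA (taddAC x). Qed.

Lemma tmulnS X (x : F X) n : tmuln x n.+1 = tadd x (tmuln x n).
Proof. by []. Qed.

Lemma tmuln_add X (x y : F X) n : tmuln (tadd x y) n = tadd (tmuln x n) (tmuln y n).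
Proof.
elim: n => [|n IH]; first by rewrite /tmuln /= tadd0.
by rewrite !tmulnS IH taddACA.
Qed.

Lemma tmulnD X (x : F X) m n : tmuln x (m + n) = tadd (tmuln x m) (tmuln x n).
Proof.
elim: m => [|m IH]; first by rewrite add0n taddC tadd0.
by rewrite addSn !tmulnS IH taddA.
Qed.

Lemma tmuln_mul X (x : F X) m n : tmuln (tmuln x m) n = tmuln x (m * n).
Proof.
elim: n => [|n IH]; first by rewrite muln0.
by rewrite tmulnS IH mulnS tmulnD.
Qed.

Lemma tres_muln X Y (f : hmap X Y) (x : F Y) n :
  tres f (tmuln x n) = tmuln (tres f x) n.
Proof. by elim: n => [|n IH]; rewrite ?tres_zero // !tmulnS tres_add IH. Qed.

Lemma ttr_muln X Y (f : hmap X Y) (x : F X) n :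
  ttr f (tmuln x n) = tmuln (ttr f x) n.
Proof. by elim: n => [|n IH]; rewrite ?ttr_zero // !tmulnS ttr_add IH. Qed.

Definition cls S X (f : hmap S X) : F X := ttr f tone.

Lemma ttr_cls S X Y (f : hmap S X) (g : hmap X Y) : ttr g (cls f) = cls (hcomp g f).
Proof. exact: ttr_comp. Qed.

Lemma cls_ext S X (f g : hmap S X) : f =1 g -> cls f = cls g.
Proof. by move=> e; apply: ttr_ext. Qed.

Lemma tres_cls V S W X (p : hmap V S) (q : hmap V W) (f : hmap S X) (g : hmap W X) :
  is_pullback p q f g -> tres g (cls f) = cls q.
Proof. by move/tres_ttr=> e; rewrite /cls e tres_one. Qed.

Lemma cls_id X : cls (hid X) = tone.
Proof. exact: ttr_id. Qed.

Lemma cls_iso S T X (f : hmap S X) (g : hmap T X) (h : hmap S T) :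
  bijective h -> hcomp g h =1 f -> cls f = cls g.
Proof.
move=> hB e; rewrite -(cls_ext e) -ttr_cls; congr ttr.
by rewrite /cls -(tres_one _ h) ttr_iso.
Qed.

Lemma tone_pair X Y : tone = tpair tone tone :> F (hsum X Y).
Proof. by apply: tpair_ext; rewrite ?tres_inl ?tres_inr tres_one. Qed.

Lemma cls_copair S T X (f : hmap S X) (g : hmap T X) :
  cls (copair f g) = tadd (cls f) (cls g).
Proof.
by rewrite /cls tone_pair /tadd -ttr_pair ttr_comp; apply: ttr_ext; case.
Qed.

Lemma cls_empty S X (f : hmap S X) : (S -> False) -> cls f = tzero.
Proof.
move=> S0; rewrite -(ttr_zero _ f); congr ttr.
exact: tval_empty.
Qed.

Lemma cls_mul S X (f : hmap S X) (b : F X) : tmul (cls f) b = ttr f (tres f b).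
Proof. by rewrite /cls frobenius tmulC tmul1. Qed.

Lemma cls_decomp S X (f : hmap S X) S1 S2 (i1 : hmap S1 S) (i2 : hmap S2 S) :
  bijective (copair i1 i2) ->
  cls f = tadd (cls (hcomp f i1)) (cls (hcomp f i2)).
Proof.
move=> iB; rewrite -cls_copair; apply/esym/(cls_iso iB).
by case.
Qed.

Definition effective X (a : F X) : Prop := exists S (f : hmap S X), a = cls f.

Lemma effective_add X (a b : F X) : effective a -> effective b -> effective (tadd a b).
Proof.
by move=> [S [f ->]] [T [g ->]]; exists (hsum S T), (copair f g); rewrite cls_copair.
Qed.

Lemma effective_muln X (a : F X) n : effective a -> effective (tmuln a n).
Proof.
move=> ea; elim: n => [|n IH]; last exact: effective_add.
by exists (hempty gT), (from_empty X); rewrite cls_empty //; case.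
Qed.

Lemma effective_ttr X Y (f : hmap X Y) (a : F X) : effective a -> effective (ttr f a).
Proof. by move=> [S [g ->]]; exists S, (hcomp f g); apply: ttr_cls. Qed.

End Multiples.

(** * Denominators *)

Section Burnside.
Variables (gT : finGroupType) (P : nat_pred) (A : tambara gT).
Hypothesis hA : local_burnside P A.
Implicit Types (X Y Z S : gset gT) (K Q H : {group gT}).

Definition fraction X (a : A X) : Prop := exists n (s s' : A X),
  [/\ P^'.-nat n, effective s, effective s' & tadd (tmuln a n) s' = s].

Lemma fraction_add X (a b : A X) : fraction a -> fraction b -> fraction (tadd a b).
Proof.
move=> [m [s [s' [Pm es es' as_]]]] [n [t [t' [Pn et et' bt]]]].
exists (m * n)%N, (tadd (tmuln s n) (tmuln t m)), (tadd (tmuln s' n) (tmuln t' m)).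
split.
- by rewrite pnatM Pm.
- by apply: effective_add; apply: effective_muln.
- by apply: effective_add; apply: effective_muln.
rewrite tmuln_add taddACA -as_ -bt -(tmuln_mul a) mulnC -(tmuln_mul b).
by rewrite -!tmuln_add.
Qed.

Lemma fraction_ttr X Y (f : hmap X Y) (a : A X) : fraction a -> fraction (ttr f a).
Proof.
move=> [n [s [s' [Pn es es' as_]]]]; exists n, (ttr f s), (ttr f s').
by split=> //; try exact: effective_ttr; rewrite -ttr_muln -ttr_add as_.
Qed.

Lemma fractionP X (a : A X) : fraction a.
Proof.
elim/gset_ind: X a => [X X0 a|K X Y i1 i2 iB IH a].
  exists 1%N, a, tzero; rewrite /tmuln /= !tadd0; split=> //.
    by exists X, (hid X); apply: tval_empty.
  by exists X, (hid X); apply: tval_empty.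
rewrite (decomp_ttr iB a); apply: fraction_add; apply: fraction_ttr => //.
have [n [S [S' [Pn e]]]] := lb_gen hA (tres i1 a).
by exists n, (tclass A S), (tclass A S'); split=> //; eexists; eexists.
Qed.

Lemma tmuln_inj X (a b : A X) n : P^'.-nat n -> tmuln a n = tmuln b n -> a = b.
Proof.
elim/gset_ind: X a b => [X X0 a b _ _|K X Y i1 i2 iB IH a b Pn e].
  exact: tval_empty.
apply: (decomp_ext iB).
  have [c [_ cU]] := lb_local hA (tmuln (tres i1 a) n) Pn.
  rewrite -(cU _ erefl); apply: cU.
  by rewrite -!tres_muln e.
by apply: IH Pn _; rewrite -!tres_muln e.
Qed.

Definition additive_on X (G : A X -> rat) : Prop :=
  forall a b, G (tadd a b) = (G a + G b)%R.

Lemma additive_muln X (G : A X -> rat) : additive_on G ->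
  forall a n, G (tmuln a n) = (G a *+ n)%R.
Proof.
move=> Gadd a; elim=> [|n IH]; last by rewrite tmulnS Gadd IH GRing.mulrS.
have /(congr1 (fun x => x - G tzero)%R) := Gadd tzero tzero.
by rewrite tadd0 GRing.addrK GRing.subrr => <-.
Qed.

(** Every element is a difference of classes up to a denominator, so an additive
    function to the rationals is determined by its values on classes. *)
Lemma additive_ext X (G G' : A X -> rat) : additive_on G -> additive_on G' ->
  (forall S (f : hmap S X), G (cls A f) = G' (cls A f)) -> G =1 G'.
Proof.
move=> Gadd G'add e a.
have [n [_ [_ [Pn [S [f ->]] [S' [f' ->]] an]]]] := fractionP a.
have := Gadd (tmuln a n) (cls A f'); rewrite an e -an G'add e.
move/GRing.addIr; rewrite !additive_muln //.
have n_gt0 : 0 < n by case/andP: Pn.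
by move/(Num.Theory.pmulrnI n_gt0).
Qed.

(** * Marks over a base *)

Variable phi : {group gT} -> A (orb [set: gT]%G) -> rat.
Hypothesis hphi : forall Q : {group gT}, is_mark P Q (phi Q).

Definition fixed_orb Q : nat := #|[set w : orb Q | Q \subset stab w]|.

(** The mark at [x] of a set over [X] counts the [Q]-fixed points over [x]. It is
    obtained from the absolute mark by restricting along the orbit of [x] and
    inducing to a point, which counts every such fixed point once for each
    [Q]-fixed coset. *)
Definition mark_at Q X (x : X) (a : A X) : rat :=
  match decP (@idP (Q \subset stab x)) with
  | left h =>
      (phi Q (ttr (bang (orb Q)) (tres (orb_map h) a)) / (fixed_orb Q)%:R)%R
  | right _ => 0%R
  end.

Lemma mark_atE Q X (x : X) (a : A X) (h : Q \subset stab x) : mark_at Q x a =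
  (phi Q (ttr (bang (orb Q)) (tres (orb_map h) a)) / (fixed_orb Q)%:R)%R.
Proof.
by rewrite /mark_at; case: decP => // h'; rewrite (bool_irrelevance h h').
Qed.

Lemma mark_at_out Q X (x : X) (a : A X) : ~~ (Q \subset stab x) -> mark_at Q x a = 0%R.
Proof. by rewrite /mark_at; case: decP => // h /negP. Qed.

Lemma mark_at_add Q X (x : X) : additive_on (@mark_at Q X x).
Proof.
move=> a b; case: (boolP (Q \subset stab x)) => h; last first.
  by rewrite !mark_at_out ?GRing.addr0.
by rewrite !(mark_atE _ h) tres_add ttr_add (mark_add (hphi Q)) GRing.mulrDl.
Qed.

(** The absolute mark is only prescribed on sets induced up from the whole group,
    and [S] is such a set by [s |-> (s, 1)]. *)
Lemma phi_cls Q S (f : hmap S (orb [set: gT]%G)) :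
  phi Q (cls A f) = (#|[set s : S | Q \subset stab s]|%:R)%R.
Proof.
have cP (s : S) : [exists t, exists h in [set: gT],
    ind_class (K := [set: gT]%G) s 1 == ind_class t h].
  by apply/existsP; exists s; apply/exists_inP; exists 1.
pose c (s : S) : hind [set: gT]%G S := exist (fun C : hind_amb [set: gT]%G S =>
  [exists t, exists h in [set: gT]%G, C == ind_class t h]) _ (cP s).
have cG s g : c (hact S s g) = hact (hind [set: gT]%G S) (c s) g.
  apply: val_inj; rewrite hsub_actE mk_hsetE ?inE //= ind_op_class.
  by rewrite mul1g -[g in RHS]mulg1 ind_class_move ?inE.
have cB : bijective (gmap cG).
  apply: inj_surj_bij => [s t /(congr1 val)/= /setP/(_ (s, 1))|[C CP]].
    have -> : (s, 1) \in ind_class s 1.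
      by apply/imsetP; exists 1; rewrite ?inE // hact1 invg1 mul1g.
    case/esym/imsetP=> k _ [-> /esym/eqP]; rewrite mulg1 invg_eq1 => /eqP ->.
    by rewrite hact1.
  have /existsP[t /exists_inP[h hH /eqP Ce]] := CP.
  exists (hact S t h); apply: val_inj; rewrite /= Ce.
  by rewrite -[h in RHS]mulg1 ind_class_move ?inE.
have -> : cls A f = tclass A S.
  apply: (@cls_iso _ _ A _ _ _ f (hind_proj [set: gT]%G S) _ cB) => s.
  exact: orb_top_unique.
rewrite (mark_class (hphi Q)); congr (_%:R)%R; apply: eq_card => s.
by rewrite inE; apply/afixP/subsetP=> sQ q qQ; move: (sQ q qQ);
  rewrite stabP => /eqP.
Qed.

Lemma fixed_orb_norm Q (w : orb Q) : Q \subset stab w -> repr (val w) \in 'N(Q).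
Proof.
have [g ->] := orb_atP w; rewrite stab_orb_at /=.
have /rcosetP[k kQ ->] := mem_repr_rcoset Q g => sQ.
rewrite groupM ?(subsetP (normG Q) k) //.
by apply/normP/eqP; rewrite eq_sym eqEcard sQ cardJg leqnn.
Qed.

Lemma fixed_orb_gt0 Q : 0 < fixed_orb Q.
Proof.
apply/card_gt0P; exists (orb_at Q 1).
by rewrite inE stab_orb_at /= conjsg1.
Qed.

Lemma sum_card (T : finType) (p q : pred T) :
  (\sum_(s | p s) (q s)%:R = #|[set s | p s && q s]|%:R :> rat)%R.
Proof.
rewrite -GRing.natr_sum -sum1dep_card big_mkcondr; congr (_%:R)%R.
Qed.

Lemma mark_at_cls Q X (x : X) S (f : hmap S X) :
  mark_at Q x (cls A f) = (\sum_(s | f s == x) (Q \subset stab s)%:R)%R.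
Proof.
case: (boolP (Q \subset stab x)) => h; last first.
  rewrite mark_at_out // big1 // => s /eqP fs.
  rewrite (_ : (Q \subset stab s) = false) //; apply: contraNF h => sQ.
  by rewrite -fs (subset_trans sQ) ?stab_map.
rewrite (mark_atE _ h) (tres_cls A (pullP f (orb_map h))) ttr_cls phi_cls.
rewrite sum_card; apply: (canLR (GRing.mulfK _)).
  by rewrite Num.Theory.pnatr_eq0 -lt0n fixed_orb_gt0.
rewrite -GRing.natrM mulnC -cardsX; congr (_%:R)%R.
(* A fixed point over the coset [Q g] is translated back by [g], which normalizes
   [Q] as the coset is fixed. *)
pose psi (u : pull f (orb_map h)) :=
  ((val u).2, hact S (val u).1 (repr (val (val u).2))^-1).
have psiI : injective psi.
  move=> u v [e]; rewrite e => /act_inj e'.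
  by apply: (pb_inj (pullP f (orb_map h))).
rewrite -(card_imset _ psiI); apply: eq_card => -[w s].
have uS (u : pull f (orb_map h)) :
    (Q \subset stab u) = (Q \subset stab (val u).1) && (Q \subset stab (val u).2).
  apply/idP/andP=> [sQ|[/subsetP s1 /subsetP s2]].
    split; apply: subset_trans sQ _.
      exact: (stab_map (pull_fst f (orb_map h))).
    exact: (stab_map (pull_snd f (orb_map h))).
  apply/subsetP=> q qQ; move: (s1 q qQ) (s2 q qQ); rewrite !stabP.
  move=> /eqP e1 /eqP e2; apply/eqP/(pb_inj (pullP f (orb_map h))); rewrite hmapG.
    exact: e1.
  exact: e2.
have fixJ (g : gT) (t : S) :
    g \in 'N(Q) -> Q \subset stab t -> Q \subset stab (hact S t g).
  move=> gN /subsetP sQ; apply/subsetP=> q qQ; rewrite stabP -hactMG.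
  rewrite -[g * q](mulgKV g) hactMG (_ : hact S t _ = t) //.
  apply/eqP; rewrite -stabP sQ // (_ : g * q * g^-1 = q ^ g^-1).
    by rewrite memJ_norm ?groupV.
  by rewrite conjgE invgK mulgA.
have repP (v : orb Q) : hact X x (repr (val v)) = orb_map h v by [].
apply/imsetP/setXP=> [[u]|[]].
  rewrite inE uS => /andP[s1 s2] [-> ->]; rewrite !inE s2 hmapG.
  rewrite [f _](pb_comm (pullP f (orb_map h)) u) -repP [hact _ _ _]hactK eqxx.
  by rewrite fixJ ?groupV ?fixed_orb_norm.
rewrite !inE => wQ /andP[/eqP fs sQ].
have [|u u1 u2] := pb_ex (pullP f (orb_map h)) (x := hact S s (repr (val w))) (w := w).
  by rewrite hmapG fs.
exists u; last by rewrite /psi [(val u).1]u1 [(val u).2]u2 hactK.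
by rewrite inE uS [(val u).1]u1 [(val u).2]u2 fixJ ?fixed_orb_norm.
Qed.

(** Induction: the fibre of a composite over [x] is the union of the fibres over
    the points above [x]. *)
Lemma mark_at_ttr Q X Y (p : hmap Y X) (x : X) (c : A Y) :
  mark_at Q x (ttr p c) = (\sum_(y | p y == x) mark_at Q y c)%R.
Proof.
move: c; apply: additive_ext => [a b|a b|S f].
- by rewrite ttr_add mark_at_add.
- by rewrite -big_split; apply: eq_bigr => y _; apply: mark_at_add.
rewrite ttr_cls mark_at_cls (partition_big f (fun y => p y == x)) //.
apply: eq_bigr => y /eqP py; rewrite mark_at_cls; apply: eq_bigl => s /=.
by apply/andP/idP=> [[] //|/eqP e]; rewrite e py !eqxx.
Qed.

Lemma mark_at_tres Q X Y (f : hmap X Y) (x : X) (a : A Y) :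
  Q \subset stab x -> mark_at Q x (tres f a) = mark_at Q (f x) a.
Proof.
move=> h; have h' := subset_trans h (stab_map f x).
rewrite (mark_atE _ h) (mark_atE _ h') tres_comp; congr (phi Q (ttr _ _) / _)%R.
by apply/tres_ext/orb_map_ext; exact: etrans (congr1 f (orb_map1 h)) (esym (orb_map1 h')).
Qed.

Lemma mark_at_one Q X (x : X) : mark_at Q x tone = ((Q \subset stab x)%:R)%R.
Proof. by rewrite -cls_id mark_at_cls (big_pred1 x). Qed.

(** Multiplying by the class of [f] is restricting along [f] and transferring
    back, so the mark of the product sums the mark of [b] over the fixed points
    of the fibre. *)
Lemma mark_at_mul Q X (x : X) (a b : A X) :
  mark_at Q x (tmul a b) = (mark_at Q x a * mark_at Q x b)%R.
Proof.
move: a; apply: additive_ext => [a a'|a a'|S f].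
- by rewrite tmulDl mark_at_add.
- by rewrite mark_at_add GRing.mulrDl.
rewrite cls_mul mark_at_ttr mark_at_cls GRing.mulr_suml; apply: eq_bigr => s /eqP fs.
case: (boolP (Q \subset stab s)) => h; first by rewrite mark_at_tres // fs GRing.mul1r.
by rewrite mark_at_out // GRing.mul0r.
Qed.

Lemma mark_at_bang Q X (x : X) (a : A (orb [set: gT]%G)) : Q \subset stab x ->
  mark_at Q x (tres (bang X) a) = phi Q a.
Proof.
move=> h; rewrite mark_at_tres //; move: a; apply: additive_ext => [a b|a b|S f].
- exact: mark_at_add.
- exact: (mark_add (hphi Q)).
rewrite mark_at_cls phi_cls sum_card; congr (_%:R)%R; apply: eq_card => s.
by rewrite !inE (orb_top_unique (f s) (bang X x)) eqxx.
Qed.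

End Burnside.

(** * Marks determine elements *)

Section Detection.
Variables (gT : finGroupType) (P : nat_pred) (A : tambara gT).
Hypothesis hA : local_burnside P A.
Variable phi : {group gT} -> A (orb [set: gT]%G) -> rat.
Hypothesis hphi : forall Q : {group gT}, is_mark P Q (phi Q).
Implicit Types (X Y Z S : gset gT) (K Q H : {group gT}).
Local Notation mark_at := (mark_at phi).

Lemma mark_at_cls_neq0 Q X (x : X) S (f : hmap S X) :
  (exists2 s, f s = x & Q \subset stab s) <-> mark_at Q x (cls A f) <> 0%R.
Proof.
rewrite (mark_at_cls hphi) sum_card; split=> [[s fs sQ]|].
  move/eqP; rewrite Num.Theory.pnatr_eq0 cards_eq0 => /eqP/setP/(_ s).
  by rewrite !inE fs eqxx sQ.
case: (set_0Vmem [set s | (f s == x) && (Q \subset stab s)]) => [-> []|].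
  by rewrite cards0.
by case=> s; rewrite inE => /andP[/eqP fs sQ] _; exists s.
Qed.

Lemma cls_orbit S S' X (f : hmap S X) (f' : hmap S' X) (s : S) (s' : S') :
  f s = f' s' -> stab s = stab s' ->
  cls A (hcomp f (orb_map (subxx (stab s))))
  = cls A (hcomp f' (orb_map (subxx (stab s')))).
Proof.
move=> ef es; have gen K (h : K \subset stab s') : K = stab s ->
  cls A (hcomp f (orb_map (subxx (stab s)))) = cls A (hcomp f' (orb_map h)).
  move=> eK; subst K; apply: cls_ext; apply: orb_map_ext.
  exact: etrans (congr1 f (orb_map1 _)) (etrans ef (congr1 f' (esym (orb_map1 h)))).
exact/gen/esym.
Qed.

(** A point of maximal stabilizer [K] contributes to the mark at [K], so the
    other set has a point with the same image and, by maximality, the same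
    stabilizer; both orbits can be removed. *)
Lemma cls_mark_inj S S' X (f : hmap S X) (f' : hmap S' X) :
  (forall Q x, mark_at Q x (cls A f) = mark_at Q x (cls A f')) -> cls A f = cls A f'.
Proof.
have [n] := ubnP #|S|; elim: n => // n IH in S S' f f' *; rewrite ltnS => leS e.
suff [[s [s' [fs ss]]]|[S0 S'0]] : (exists s s', f s = f' s' /\ stab s = stab s')
    \/ (S -> False) /\ (S' -> False).
- have dS := cls_decomp A f (orbit_decomposition s).
  have dS' := cls_decomp A f' (orbit_decomposition s').
  rewrite dS dS' (cls_orbit fs ss); congr tadd.
  apply: IH (leq_trans (card_complement s) leS) _ => Q x.
  have := e Q x; rewrite dS dS' !(mark_at_add hphi) (cls_orbit fs ss).
  exact: GRing.addrI.
- by rewrite !cls_empty.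
case: (pickP (mem (hsum S S'))) => [u0 _|none]; last first.
  by right; split=> s; [have := none (inl s)|have := none (inr s)].
left; pose u := [arg max_(u > u0) #|stab (u : hsum S S')|].
have um (v : hsum S S') : #|stab v| <= #|stab u|.
  by rewrite /u; case: arg_maxnP => // w _; apply.
have eqm K K' : K \subset K' -> #|K'| <= #|K| -> K = K'.
  by move=> sK le; apply/group_inj/eqP; rewrite eqEcard sK.
case: u um => [s|s'] um.
  have [s' fs' ss'] : exists2 s', f' s' = f s & stab s \subset stab s'.
    by apply/mark_at_cls_neq0; rewrite -e; apply/mark_at_cls_neq0; exists s.
  exists s, s'; split=> //; apply: eqm => //.
  by have := um (inr s'); rewrite stab_inl stab_inr.
have [s fs ss] : exists2 s, f s = f' s' & stab s' \subset stab s.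
  by apply/mark_at_cls_neq0; rewrite e; apply/mark_at_cls_neq0; exists s'.
exists s, s'; split=> //; apply/esym/eqm => //.
by have := um (inl s); rewrite stab_inl stab_inr.
Qed.

Lemma mark_inj X (a b : A X) : (forall Q x, mark_at Q x a = mark_at Q x b) -> a = b.
Proof.
move=> e.
have [m [_ [_ [Pm [S [f ->]] [S' [f' ->]] am]]]] := fractionP hA a.
have [n [_ [_ [Pn [T [g ->]] [T' [g' ->]] bn]]]] := fractionP hA b.
have mmul Q x (c : A X) k : mark_at Q x (tmuln c k) = (mark_at Q x c *+ k)%R.
  exact/additive_muln/mark_at_add.
have Pmn : P^'.-nat (m * n)%N by rewrite pnatM Pm.
(* Multiplied by [m * n], both elements are differences of classes; moving the
   negative terms across reduces the claim to an equality of two classes. *)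
apply: (tmuln_inj hA Pmn).
have [U [h Uh]] : effective (tadd (tmuln (cls A f) n) (tmuln (cls A g') m)).
  by apply: effective_add; apply: effective_muln; eexists; eexists.
have [U' [h' Uh']] : effective (tadd (tmuln (cls A g) m) (tmuln (cls A f') n)).
  by apply: effective_add; apply: effective_muln; eexists; eexists.
have hh : cls A h = cls A h'.
  apply: cls_mark_inj => Q x; rewrite -Uh -Uh' !(mark_at_add hphi) !mmul -am -bn.
  rewrite !(mark_at_add hphi) !mmul e !GRing.mulrnDl -!GRing.mulrnA mulnC.
  by rewrite -!GRing.addrA; congr (_ + _)%R; apply: GRing.addrC.
apply: (@tadd_cancel _ _ _ _ _ _ (tadd (tmuln (cls A f') n) (tmuln (cls A g') m))).
rewrite -{1}(tmuln_mul a) [(m * n)%N in RHS]mulnC -(tmuln_mul b).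
rewrite taddA -tmuln_add am [in RHS](taddC (tmuln (cls A f') n)) taddA -tmuln_add bn.
by rewrite Uh Uh'.
Qed.
End Detection.

(** * Marks of norms *)

Arguments cadm {gT X Y} w.

Section Norms.
Variables (gT : finGroupType) (P : nat_pred) (A : tambara gT).
Hypothesis hA : local_burnside P A.
Variable phi : {group gT} -> A (orb [set: gT]%G) -> rat.
Hypothesis hphi : forall Q : {group gT}, is_mark P Q (phi Q).
Implicit Types (X Y Z S : gset gT) (K Q H : {group gT}).
Local Notation mark_at := (mark_at phi).

Definition nrm X Y (f : hmap X Y) : A X -> A Y := tnrm (cadm (Nb f)).

Section Sections.
Variables (S Y Z : gset gT) (g : hmap S Y) (f : hmap Y Z).
Local Notation secs := (bsec (Tb g) (Nb f)).
Local Notation comp := (bcomp (Tb g) (Nb f)).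

Lemma nrm_ttr (c : A S) :
  nrm f (ttr g c) = ttr (btr comp) (nrm (bnrm comp) (tres (bres comp) c)).
Proof.
transitivity (tmor (b := A) (cadm comp) c).
  exact/esym/(@tmor_comp _ _ A _ _ _ (Tb g) (Nb f)).
by rewrite tmorE; congr ttr; apply: tnrm_ext.
Qed.

Definition sec_at (d : secs) (y : Y) : option S := (val d).2 y.

Lemma sec_at_over (d : secs) y : f y = (val d).1 -> omap g (sec_at d y) = Some y.
Proof.
case: d => d dP /= fy; have /forallP/(_ y) := dP.
by rewrite /sec_at /= fy eqxx => /eqP.
Qed.

Lemma sec_at_out (d : secs) y : f y <> (val d).1 -> sec_at d y = None.
Proof.
case: d => d dP /= /eqP/negPf fy; have /forallP/(_ y) := dP.
by rewrite /sec_at /= fy => /eqP.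
Qed.

Lemma sec_at_act (d : secs) y a :
  sec_at (hact secs d a) y = omap (fun s => hact S s a) (sec_at d (hact Y y a^-1)).
Proof. by rewrite /sec_at bsec_actE /= ffunE. Qed.

Lemma sec_ext (d d' : secs) :
  (val d).1 = (val d').1 -> sec_at d =1 sec_at d' -> d = d'.
Proof.
move=> e e'; apply: val_inj; rewrite [LHS]surjective_pairing [RHS]surjective_pairing.
by congr pair => //; apply/ffunP.
Qed.

(** A map splitting [g] picks one section over each point of [Z], and along it
    the norm of the exponential diagram restricts to the norm of [f]. *)
Section Splitting.
Variables (i : hmap Y S) (gi : forall y, g (i y) = y).

Lemma split_secP z : sec_pred ((z, [ffun y => if f y == z then Some (i y) else None]) :
  hprod (bmid (Nb f)) (hpfun (bdom (Nb f)) (bmid (Tb g)))).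
Proof.
apply/forallP=> y; rewrite ffunE.
rewrite /=; case: (boolP (f y == z)) => //= _.
by rewrite gi.
Qed.
Definition split_sec_fun z : secs := exist (@sec_pred _ _ _ _ (Tb g) (Nb f))
  ((z, [ffun y => if f y == z then Some (i y) else None]) :
    hprod (bmid (Nb f)) (hpfun (bdom (Nb f)) (bmid (Tb g)))) (split_secP z).
Lemma split_sec_atE z y :
  sec_at (split_sec_fun z) y = if f y == z then Some (i y) else None.
Proof. by rewrite /sec_at /= ffunE. Qed.
Lemma split_sec_subproof z a :
  split_sec_fun (hact Z z a) = hact secs (split_sec_fun z) a.
Proof.
apply: sec_ext; first by rewrite bsec_actE.
move=> y; rewrite sec_at_act !split_sec_atE -{1}(hactKV a y) hmapG.
rewrite (inj_eq (act_inj (hact Z) a)); case: ifP => //= _.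
by rewrite -hmapG hactKV.
Qed.
Definition split_sec : hmap Z secs := gmap split_sec_subproof.

Lemma split_sec_base z : (val (split_sec z)).1 = z.
Proof. by []. Qed.
Lemma split_sec_at y : sec_at (split_sec (f y)) y = Some (i y).
Proof. by have := split_sec_atE (f y) y; rewrite eqxx. Qed.

Lemma split_ptP y : pt_pred (((i y, y), split_sec (f y)) :
  hprod (hprod (bdom (Tb g)) (bdom (Nb f))) secs).
Proof. by rewrite /pt_pred /= eqxx ffunE !eqxx. Qed.
Definition split_pt_fun y : bpts (Tb g) (Nb f) := exist (@pt_pred _ _ _ _ (Tb g) (Nb f))
  (((i y, y), split_sec (f y)) : hprod (hprod (bdom (Tb g)) (bdom (Nb f))) secs)
  (split_ptP y).
Lemma split_pt_subproof y a :
  split_pt_fun (hact Y y a) = hact (bpts (Tb g) (Nb f)) (split_pt_fun y) a.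
Proof.
apply: val_inj; rewrite hsub_actE hprod_actE /hprod_op hprod_actE /hprod_op.
rewrite [LHS]/=; congr (_, _, _); first exact: hmapG.
by rewrite [split_pt_fun _]lock /= -lock; rewrite [f _]hmapG; exact: hmapG split_sec _ _.
Qed.
Definition split_pt : hmap Y (bpts (Tb g) (Nb f)) := gmap split_pt_subproof.

Lemma split_pullback : is_pullback split_pt f (bnrm comp) split_sec.
Proof.
split=> [//|u z e|y y' /(congr1 (fun u => (val u).1.2)) //].
case: u e => -[[s y] d] uP /= e.
have /andP[/= /eqP fy /eqP sy] := uP.
have fz : f y = z by rewrite fy e.
exists y => //; apply: val_inj => /=.
have -> : s = i y by move: sy; rewrite e /= ffunE fz eqxx => -[].
by congr pair; rewrite e -fz.
Qed.

Lemma tres_split_sec (c : A S) :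
  tres split_sec (nrm (bnrm comp) (tres (bres comp) c)) = nrm f (tres i c).
Proof.
rewrite (tres_tnrm _ (cadm (Nb f)) _ split_pullback) tres_comp.
by rewrite /nrm; congr tnrm; apply: tres_ext.
Qed.
End Splitting.
End Sections.

Section TransitiveFibre.
Variables (Y Z : gset gT) (f : hmap Y Z) (Q : {group gT}) (y : Y).
Hypothesis Qz : Q \subset stab (f y).
Hypothesis trans : forall y', f y' = f y -> exists2 q, q \in Q & y' = hact Y y q.

Section Fixed.
Variables (S : gset gT) (g : hmap S Y).
Local Notation secs := (bsec (Tb g) (Nb f)).

Lemma fixed_sec (d : secs) q : Q \subset stab d -> q \in Q ->
  sec_at d (hact Y y q) = omap (fun s => hact S s q) (sec_at d y).
Proof.
move=> /subsetP sQ qQ; have := sQ q qQ; rewrite stabP => /eqP e.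
by rewrite -{1}e sec_at_act hactK.
Qed.

Lemma fixed_sec_inj (d d' : secs) : (val d).1 = f y -> (val d').1 = f y ->
  Q \subset stab d -> Q \subset stab d' -> sec_at d y = sec_at d' y -> d = d'.
Proof.
move=> dy d'y sd sd' e; apply: sec_ext => [|y']; first by rewrite dy.
have [e'|ne] := eqVneq (f y') (f y).
  by have [q qQ ->] := trans e'; rewrite !fixed_sec // e.
by rewrite !sec_at_out // ?dy ?d'y; apply/eqP.
Qed.

Lemma fixed_sec_val (d : secs) : (val d).1 = f y -> Q \subset stab d ->
  exists2 s, sec_at d y = Some s & g s = y /\ Q :&: stab y \subset stab s.
Proof.
move=> dy sd; have := @sec_at_over _ _ _ _ _ d y (esym dy).
case e: (sec_at d y) => [s|] //= [gs]; exists s => //; split=> //.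
apply/subsetP=> q /setIP[qQ]; rewrite !stabP => /eqP yq.
by have := fixed_sec sd qQ; rewrite yq e => -[/esym/eqP].
Qed.

(** The value at [y] is transported along the fibre by [Q], which is consistent
    because it is fixed by the stabilizer of [y] in [Q]. *)
Lemma fixed_sec_ex s : g s = y -> Q :&: stab y \subset stab s ->
  exists d : secs, [/\ (val d).1 = f y, Q \subset stab d & sec_at d y = Some s].
Proof.
move=> gs sQ; pose v y' := omap (hact S s) [pick q in Q | hact Y y q == y'].
have vE q : q \in Q -> v (hact Y y q) = Some (hact S s q).
  move=> qQ; rewrite /v; case: pickP => [q' /andP[q'Q /eqP e]|/(_ q)]; last first.
    by rewrite qQ eqxx.
  have e1 : hact S s (q' * q^-1) = s.
    apply/eqP; rewrite -stabP (subsetP sQ) // in_setI groupM ?groupV // stabP.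
    by rewrite hactMG e hactK eqxx.
  by congr Some; rewrite -{2}e1 -hactMG mulgKV.
have vN y' : f y' <> f y -> v y' = None.
  move=> ne; rewrite /v; case: pickP => // q /andP[qQ /eqP e]; case: ne.
  by rewrite -e hmapG; apply/eqP; rewrite -stabP (subsetP Qz).
have dP : sec_pred ((f y, [ffun y' => v y']) :
    hprod (bmid (Nb f)) (hpfun (bdom (Nb f)) (bmid (Tb g)))).
  apply/forallP=> y'; rewrite ffunE; case: eqP => [e|ne]; last by rewrite vN.
  by have [q qQ ->] := trans e; rewrite vE //= hmapG gs.
pose d : secs := exist (@sec_pred _ _ _ _ (Tb g) (Nb f)) _ dP.
have dE y' : sec_at d y' = v y' by rewrite /sec_at /= ffunE.
exists d; split=> //; last by rewrite dE -[y in v y]hact1 vE // hact1.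
apply/subsetP=> q qQ; rewrite stabP; apply/eqP; have zq : hact Z (f y) q = f y.
  by apply/eqP; rewrite -stabP (subsetP Qz).
apply: sec_ext => [|y']; first by rewrite bsec_actE.
rewrite sec_at_act !dE; have [e|ne] := eqVneq (f y') (f y).
  have [q' q'Q ->] := trans e.
  by rewrite -hactMG !vE ?groupM ?groupV //= -hactMG mulgKV.
rewrite !vN //; apply/eqP => //; apply: contraNneq ne => e.
by rewrite -(hactKV q y') hmapG e zq.
Qed.
End Fixed.

(** The fixed points of a coinduced set: [Q]-equivariant sections over the orbit of
    [y] correspond to points over [y] fixed by its stabilizer in [Q]. *)
Lemma mark_nrm_cls S (g : hmap S Y) :
  mark_at Q (f y) (nrm f (cls A g)) = mark_at (Q :&: stab y)%G y (cls A g).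
Proof.
rewrite nrm_ttr tres_one /nrm tnrm_one -/(cls A _) !(mark_at_cls hphi) !sum_card.
congr (_%:R)%R.
set D := [set d | _]; set B := [set s | _].
have evI : {in D &, injective (fun d : bsec (Tb g) (Nb f) => sec_at d y)}.
  move=> d d'; rewrite !inE => /andP[/eqP d1 sd] /andP[/eqP d1' sd'].
  exact: fixed_sec_inj.
rewrite -(card_in_imset evI) -(card_imset B (@Some_inj _)).
apply: eq_card => o; apply/imsetP/imsetP=> -[].
  move=> d; rewrite inE => /andP[/eqP d1 sd] ->.
  have [s es [gs ss]] := fixed_sec_val d1 sd.
  by exists s; rewrite // inE gs eqxx.
move=> s; rewrite inE => /andP[/eqP gs ss] ->.
have [d [d1 sd ds]] := fixed_sec_ex gs ss.
by exists d; rewrite // inE sd andbT; apply/eqP.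
Qed.

(** Norms are additive modulo transfers: of the sections of the fold map, only
    the two constant ones are fixed by [Q]. *)
Lemma mark_nrm_add : additive_on (fun a => mark_at Q (f y) (nrm f a)).
Proof.
move=> a b; rewrite {1}/tadd nrm_ttr (mark_at_ttr hA hphi).
pose dl := split_sec f (i := hinl Y Y) (g := hfold Y) (fun=> erefl).
pose dr := split_sec f (i := hinr Y Y) (g := hfold Y) (fun=> erefl).
have md (j : hmap Y (hsum Y Y)) (ij : forall z, hfold Y (j z) = z) :
    mark_at Q (split_sec f ij (f y))
    (nrm (bnrm (bcomp (Tb (hfold Y)) (Nb f)))
      (tres (bres (bcomp (Tb (hfold Y)) (Nb f))) (tpair a b)))
    = mark_at Q (f y) (nrm f (tres j (tpair a b))).
  by rewrite -mark_at_tres // tres_split_sec.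
have dlr : dr (f y) != dl (f y).
  apply/eqP=> /(congr1 (fun d => sec_at d y)).
  by rewrite !split_sec_at.
rewrite (bigD1 (dl (f y))); last exact: eqxx.
rewrite (bigD1 (dr (f y))); last by apply/andP; split=> //; apply: eqxx.
rewrite !md tres_inl tres_inr big1 => [|d]; first by rewrite /= GRing.addr0.
case/andP=> /andP[/eqP d1 dl'] dr'.
case: (boolP (Q \subset stab d)) => [sd|]; last exact: mark_at_out.
have only (j : hmap Y (hsum Y Y)) (ij : forall z, hfold Y (j z) = z) :
    sec_at d y = Some (j y) -> d = split_sec f ij (f y).
  move=> ed; apply: (fixed_sec_inj d1 (split_sec_base _ _ _) sd).
    exact: subset_trans Qz (stab_map _ _).
  exact: etrans ed (esym (split_sec_at f ij y)).
have [[y'|y'] ed [/= ey _]] := fixed_sec_val d1 sd; rewrite ey in ed.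
  by case/eqP: dl'; apply: only.
by case/eqP: dr'; apply: only.
Qed.

Lemma mark_nrm_transitive (a : A Y) :
  mark_at Q (f y) (nrm f a) = mark_at (Q :&: stab y)%G y a.
Proof.
move: a; apply: (additive_ext hA mark_nrm_add) => [a b|S g].
  exact: mark_at_add.
exact: mark_nrm_cls.
Qed.
End TransitiveFibre.
End Norms.

(** * Restrictions of an idempotent *)

Section Spread.
Variables (gT : finGroupType) (I : indexing gT) (F : bifunctor I).
Implicit Types X Y Z : gset gT.

Definition spread (e : F (orb [set: gT]%G)) X : F X := tres (bang X) e.

Lemma tres_spread e X Y (f : hmap X Y) : tres f (spread e Y) = spread e X.
Proof. by rewrite /spread tres_comp; apply: tres_ext => x; apply: orb_top_unique. Qed.

Lemma spread_to_top e (H : {group gT}) : tres (to_top H) e = spread e (orb H).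
Proof. by apply: tres_ext => x; apply: orb_top_unique. Qed.

Lemma spread_top e : spread e (orb [set: gT]%G) = e.
Proof.
by rewrite -[RHS]tres_id; apply: tres_ext => x; apply: orb_top_unique.
Qed.

Lemma spread_idem e X : tmul e e = e -> tmul (spread e X) (spread e X) = spread e X.
Proof. by move=> ee; rewrite /spread -tres_mul ee. Qed.

(** Inverting an idempotent amounts to setting it to [1]. *)
Lemma idem_unit_one X (u : F X) : tmul u u = u -> tunit u -> u = tone.
Proof. by move=> uu [y uy]; rewrite -(tmul1 u) -uy tmulA uu. Qed.

Lemma texp_idem X (u : F X) k : tmul u u = u -> tmul u (texp u k) = u.
Proof.
move=> uu; elim: k => [|k IH]; first exact: tmul1.
by rewrite /texp iterS tmulA uu.
Qed.
End Spread.

(** * The norm of the restricted idempotent *)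
Section NormOfIdempotent.
Variables (gT : finGroupType) (P : nat_pred) (A : tambara gT).
Hypothesis hA : local_burnside P A.
Variable phi : {group gT} -> A (orb [set: gT]%G) -> rat.
Hypothesis hphi : forall Q : {group gT}, is_mark P Q (phi Q).
Variable e : A (orb [set: gT]%G).
Implicit Types (X Y Z S : gset gT) (K Q H : {group gT}).
Local Notation mark_at := (mark_at phi).
Local Notation base Q := (orb_at Q 1).

Lemma stab_base Q : stab (base Q) = Q.
Proof. by rewrite stab_orb_at; apply/group_inj; rewrite /= conjsg1. Qed.

Lemma stab_inj X Y (f : hmap X Y) x : injective f -> stab (f x) = stab x.
Proof.
by move=> fI; apply/group_inj/setP=> g; rewrite !stabP -hmapG (inj_eq fI).
Qed.

Lemma complement_map_inj X (x : X) : injective (@complement_map _ X x).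
Proof. by move=> u v /val_inj. Qed.

(** One [Q]-orbit of the fibre over the base point is the fibre of one orbit of
    [Y], since the target is a single orbit. *)
Lemma mark_nrm_orbit Y Q (f : hmap Y (orb Q)) y : f y = base Q ->
  mark_at Q (base Q) (nrm f (spread e Y))
  = (phi (Q :&: stab y)%G e * mark_at Q (base Q)
      (nrm (hcomp f (@complement_map _ Y y)) (spread e (complement y))))%R.
Proof.
move=> fy; rewrite /nrm (decomp_tnrm (orbit_decomposition y) _
  (cadm (Nb (hcomp f (orb_map (subxx (stab y))))))
  (cadm (Nb (hcomp f (@complement_map _ Y y))))).
rewrite !tres_spread (mark_at_mul hA hphi); congr (_ * _)%R.
pose f1 := hcomp f (orb_map (subxx (stab y))).
have f1b : f1 (base (stab y)) = base Q.
  by rewrite /f1 -[RHS]fy -[in RHS](orb_map1 (subxx (stab y))).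
rewrite -[X in mark_at _ X _]f1b -/(nrm f1 _) (mark_nrm_transitive hA hphi).
- rewrite (mark_at_bang hA hphi) ?subsetIr //; congr (phi _ e).
  by rewrite stab_base.
- by rewrite f1b stab_base.
move=> y'; have [g ->] := orb_atP y'.
rewrite f1b -[g]mul1g -orb_at_act hmapG f1b => fg; exists g => //.
by move/eqP: fg; rewrite -stabP stab_base.
Qed.

Lemma mark_nrm_orb_one Y Q (f : hmap Y (orb Q)) :
  (forall y, f y = base Q -> phi (Q :&: stab y)%G e = 1%R) ->
  mark_at Q (base Q) (nrm f (spread e Y)) = 1%R.
Proof.
have [n] := ubnP #|Y|; elim: n => // n IH in Y f *; rewrite ltnS => leY e1.
case: (pickP (fun y => f y == base Q)) => [y /eqP fy|none].
  rewrite (mark_nrm_orbit fy) e1 // GRing.mul1r.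
  apply: IH (leq_trans (card_complement y) leY) _ => u fu.
  rewrite -(e1 _ fu); congr (phi _ e).
  by rewrite (stab_inj u (@complement_map_inj Y y)).
have Y0 : Y -> False.
  move=> y; have [g fg] := orb_atP (f y).
  by have := none (hact Y y g^-1); rewrite hmapG fg orb_at_act mulgV eqxx.
rewrite (tval_empty Y0 (spread e Y) tone) /nrm tnrm_one (mark_at_one hphi).
by rewrite stab_base subxx.
Qed.

Section OverPoint.
Variables (Y Z : gset gT) (f : hmap Y Z) (Q : {group gT}) (z : Z).
Hypothesis Qz : Q \subset stab z.
Let Yz := pull f (orb_map Qz).

Lemma mark_nrm_pull : mark_at Q z (nrm f (spread e Y))
  = mark_at Q (base Q) (nrm (pull_snd f (orb_map Qz)) (spread e Yz)).
Proof.
rewrite -{1}(orb_map1 Qz) -mark_at_tres ?stab_base //.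
by rewrite (tres_tnrm _ (cadm (Nb (pull_snd f (orb_map Qz)))) _ (pullP _ _)) tres_spread.
Qed.

Lemma pull_stab (u : Yz) : pull_snd f (orb_map Qz) u = base Q ->
  Q :&: stab u = Q :&: stab (pull_fst f (orb_map Qz) u).
Proof.
move=> ub; apply/setP=> q; rewrite in_setI [RHS]in_setI.
case qQ: (q \in Q) => //; rewrite !andTb.
apply/idP/idP=> [|qu]; first apply: (subsetP (stab_map (pull_fst f (orb_map Qz)) u)).
rewrite stabP; apply/eqP/(pb_inj (pullP f (orb_map Qz))); rewrite hmapG.
  by apply/eqP; rewrite -stabP.
by rewrite ub; apply/eqP; rewrite -stabP stab_base.
Qed.

Lemma mark_nrm_one :
  (forall y, f y = z -> phi (Q :&: stab y)%G e = 1%R) ->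
  mark_at Q z (nrm f (spread e Y)) = 1%R.
Proof.
move=> e1; rewrite mark_nrm_pull; apply: mark_nrm_orb_one => u ub.
rewrite -(e1 (pull_fst f (orb_map Qz) u)).
  by congr (phi _ e); apply/group_inj/pull_stab.
by rewrite (pb_comm (pullP f (orb_map Qz))) ub orb_map1.
Qed.

Lemma mark_nrm_zero y : f y = z -> phi (Q :&: stab y)%G e = 0%R ->
  mark_at Q z (nrm f (spread e Y)) = 0%R.
Proof.
move=> fy e0; rewrite mark_nrm_pull.
have [|u uy ub] := pb_ex (pullP f (orb_map Qz)) (x := y) (w := base Q).
  by rewrite orb_map1.
rewrite (mark_nrm_orbit ub) (_ : (Q :&: stab u)%G = (Q :&: stab y)%G) ?e0 ?GRing.mul0r //.
by apply/group_inj; rewrite -uy; apply: pull_stab.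
Qed.
End OverPoint.
End NormOfIdempotent.

(** * Morphisms preserve the ring structure *)

Section Morphisms.
Variables (gT : finGroupType) (I : indexing gT) (B C : itambara I) (psi : tmap B C).
Implicit Types X Y Z : gset gT.

Lemma tmap_res X Y (f : hmap X Y) (b : B Y) : psi _ (tres f b) = tres f (psi _ b).
Proof. exact: tmapP. Qed.

Lemma tmap_nrm X Y (f : hmap X Y) (h : badm I (Nb f)) (b : B X) :
  psi _ (tnrm h b) = tnrm h (psi _ b).
Proof. exact: tmapP. Qed.

Lemma tmap_pair X Y (x : B X) (y : B Y) :
  psi _ (tpair x y) = tpair (psi _ x) (psi _ y).
Proof.
by apply: tpair_ext; rewrite ?tres_inl ?tres_inr -tmap_res ?tres_inl ?tres_inr.
Qed.

Lemma tmap_one X : psi X tone = tone.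
Proof. by rewrite !toneE tmap_nrm; congr tnrm; apply: tpt_unique. Qed.

Lemma tmap_mul X (x y : B X) : psi _ (tmul x y) = tmul (psi _ x) (psi _ y).
Proof. by rewrite !tmulE tmap_nrm tmap_pair. Qed.

Lemma tmap_texp X (x : B X) k : psi _ (texp x k) = texp (psi _ x) k.
Proof.
by elim: k => [|k IH]; [exact: tmap_one|rewrite /texp !iterS tmap_mul -/(texp _ _) IH].
Qed.

Lemma tmap_spread (e : B (orb [set: gT]%G)) X :
  psi _ (spread e X) = spread (psi _ e) X.
Proof. exact: tmap_res. Qed.

Lemma tmap_spread_one (e : B (orb [set: gT]%G)) X : tmul e e = e ->
  tunit (psi _ e) -> psi _ (spread e X) = tone.
Proof.
move=> ee eu; rewrite tmap_spread (_ : psi _ e = tone) ?/spread ?tres_one //.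
by apply: idem_unit_one eu; rewrite -tmap_mul ee.
Qed.

Lemma texp_one X k : texp (tone : B X) k = tone.
Proof. by elim: k => // k IH; rewrite /texp iterS -/(texp _ _) IH tmul1. Qed.
End Morphisms.

(** * Splitting off an idempotent *)
Section Splitting.
Variables (gT : finGroupType) (I : indexing gT) (A : tambara gT).
Variable e : A (orb [set: gT]%G).
Hypothesis ee : tmul e e = e.
Hypothesis nrm_e : forall (Y Z : gset gT) (f : hmap Y Z), badm I (Nb f) ->
  tmul (spread e Z) (nrm f (spread e Y)) = spread e Z.
Implicit Types X Y Z : gset gT.

(** A factor [e] inside the norm comes out as the norm of [e], which the outer [e]
    absorbs, after it has been moved under the transfer. *)
Lemma tmor_spread X Y (w : bispan X Y) (x : A X) : badm I w ->
  tmul (spread e Y) (tmor (cadm w) (tmul (spread e X) x))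
  = tmul (spread e Y) (tmor (cadm w) x).
Proof.
move=> hw; rewrite !tmorE tres_mul tnrm_mul tres_spread.
rewrite !(tmulC (spread e Y)) !frobenius tres_spread; congr ttr.
rewrite (tmulC (tnrm _ (spread _ _))) -tmulA; congr tmul.
rewrite tmulC (tnrm_ext _ (cadm _) (frefl _)); exact: nrm_e.
Qed.

(** The localization at an idempotent is the summand it cuts out: at [X], the
    elements on which [e] acts as the identity. *)
Definition part X : Type := {x : A X | tmul (spread e X) x = x}.

Lemma part_ext X (x y : part X) : sval x = sval y -> x = y.
Proof.
case: x y => [x hx] [y hy] /= e'; subst y.
by rewrite (proof_irrelevance _ hx hy).
Qed.

Lemma to_part_subproof X (a : A X) :
  tmul (spread e X) (tmul (spread e X) a) = tmul (spread e X) a.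
Proof. by rewrite tmulA spread_idem. Qed.
Definition to_part X (a : A X) : part X := exist _ _ (to_part_subproof a).

Lemma to_partK X (x : part X) : to_part (sval x) = x.
Proof. by apply: part_ext; apply: (svalP x). Qed.

Definition part_mor X Y (w : bispan X Y) (_ : badm I w) (x : part X) : part Y :=
  to_part (tmor (cadm w) (sval x)).

Lemma tmor_res X Y (f : hmap X Y) (a : A Y) : tmor (cadm (Rb f)) a = tres f a.
Proof. exact: tmor_irr. Qed.

Lemma part_mor_iso X Y (w w' : bispan X Y) (hw : badm I w) (hw' : badm I w') :
  biso w w' -> part_mor hw =1 part_mor hw'.
Proof. by move=> i x; rewrite /part_mor (tmor_iso _ (cadm w') i). Qed.

Lemma part_mor_id X (h : badm I (Rb (hid X))) : part_mor h =1 id.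
Proof. by move=> x; rewrite /part_mor tmor_res tres_id to_partK. Qed.

Lemma part_mor_comp X Y Z (w1 : bispan X Y) (w2 : bispan Y Z)
    (h1 : badm I w1) (h2 : badm I w2) (h12 : badm I (bcomp w1 w2)) :
  part_mor h12 =1 part_mor h2 \o part_mor h1.
Proof.
move=> x; apply: part_ext; rewrite /= tmor_spread //; congr tmul.
exact: (tmor_comp (b := A)).
Qed.

Lemma part_pt_subproof : tmul (spread e (hempty gT)) (tpt A) = tpt A.
Proof. exact: tpt_unique. Qed.
Definition part_pt : part (hempty gT) := exist _ _ part_pt_subproof.
Lemma part_ptP (x : part (hempty gT)) : x = part_pt.
Proof. by apply: part_ext; apply: tpt_unique. Qed.

Lemma part_pair_subproof X Y (x : part X) (y : part Y) :
  tmul (spread e (hsum X Y)) (tpair (sval x) (sval y)) = tpair (sval x) (sval y).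
Proof.
apply: tpair_ext; rewrite tres_mul tres_spread ?tres_inl ?tres_inr.
  exact: (svalP x).
exact: (svalP y).
Qed.
Definition part_pair X Y (x : part X) (y : part Y) : part (hsum X Y) :=
  exist _ _ (part_pair_subproof x y).

Lemma part_pairl X Y (x : part X) (y : part Y) :
  part_mor (Rb_adm I (hinl X Y)) (part_pair x y) = x.
Proof. by rewrite /part_mor tmor_res tres_inl to_partK. Qed.
Lemma part_pairr X Y (x : part X) (y : part Y) :
  part_mor (Rb_adm I (hinr X Y)) (part_pair x y) = y.
Proof. by rewrite /part_mor tmor_res tres_inr to_partK. Qed.
Lemma part_pair_eta X Y (z : part (hsum X Y)) :
  part_pair (part_mor (Rb_adm I (hinl X Y)) z) (part_mor (Rb_adm I (hinr X Y)) z) = z.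
Proof.
apply: part_ext; rewrite /= !tmor_res; apply: tpair_ext.
  by rewrite tres_inl -(tres_spread e (hinl X Y)) -tres_mul (svalP z).
by rewrite tres_inr -(tres_spread e (hinr X Y)) -tres_mul (svalP z).
Qed.

Definition part_bifunctor : bifunctor I :=
  Bifunctor part_mor_iso part_mor_id part_mor_comp part_ptP
    part_pairl part_pairr part_pair_eta.

Lemma tmulDr X (x y z : A X) : tmul x (tadd y z) = tadd (tmul x y) (tmul x z).
Proof. by rewrite !(tmulC x) tmulDl. Qed.

Lemma part_add X (x y : part_bifunctor X) : sval (tadd x y) = tadd (sval x) (sval y).
Proof.
rewrite /= (tmor_irr _ (Tb_adm _ _)) -/(ttr _ _) -/(tadd _ _) tmulDr.
by rewrite (svalP x) (svalP y).
Qed.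
Lemma part_zero X : sval (tzero : part_bifunctor X) = tzero.
Proof.
by rewrite /= (tmor_irr _ (Tb_adm _ _)) -/(ttr _ _) -/(tzero) tmulC tmul0.
Qed.

Lemma part_addA X (x y z : part_bifunctor X) : tadd x (tadd y z) = tadd (tadd x y) z.
Proof. by apply: part_ext; rewrite !part_add taddA. Qed.
Lemma part_addC X (x y : part_bifunctor X) : tadd x y = tadd y x.
Proof. by apply: part_ext; rewrite !part_add taddC. Qed.
Lemma part_add0 X (x : part_bifunctor X) : tadd x tzero = x.
Proof. by apply: part_ext; rewrite part_add part_zero tadd0. Qed.
Lemma part_addN X (x : part_bifunctor X) : exists y, tadd x y = tzero.
Proof.
have [y xy] := taddN (sval x); exists (to_part y); apply: part_ext.
by rewrite part_add part_zero -{1}(svalP x) -tmulDr xy tmulC tmul0.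
Qed.

Definition part_tambara : itambara I :=
  ITambara part_addA part_addC part_add0 part_addN.

Lemma to_part_natural X Y (w : bispan X Y) (hw : badm I w) (a : forget I A X) :
  to_part (tmor hw a) = tmor (b := part_tambara) hw (to_part a).
Proof. by apply: part_ext; rewrite /= tmor_spread. Qed.
Definition part_map : tmap (forget I A) part_tambara :=
  @TMap _ _ (forget I A) part_tambara to_part to_part_natural.

Lemma part_map_localization : is_localization part_map e.
Proof.
have sE X : spread (e : forget I A _) X = spread e X by apply: tmor_irr.
have mE X (a b : forget I A X) : tmul a b = tmul (a : A X) b by apply: tmor_irr.
have oneE X : sval (tone : part_bifunctor X) = spread e X.
  by rewrite /= (tmor_irr _ (empty_adm _ _)) -/(tone) tmul1.
have e1 X : part_map X (spread (e : forget I A _) X) = tone.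
  by apply: part_ext; rewrite oneE sE /= spread_idem.
split=> [H|H b|H a a'].
- by rewrite spread_to_top e1; exists tone; apply: tmul1.
- exists (sval b), 0%N; rewrite [texp _ _]/(tone) tmap_one tmul1.
  exact/esym/to_partK.
move/(congr1 sval) => aa; exists 1%N; rewrite spread_to_top sE.
have texp1 (x : forget I A (orb H)) : texp x 1 = x by exact: tmul1.
by rewrite texp1 !mE; apply: aa.
Qed.
End Splitting.

(** * The universal property *)
Section Universal.
Variables (gT : finGroupType) (I : indexing gT) (A B : itambara I) (eta : tmap A B).
Variable e : A (orb [set: gT]%G).
Hypothesis ee : tmul e e = e.
Hypothesis loc : is_localization eta e.
Implicit Types X Y Z : gset gT.

Lemma loc_spread X : eta _ (spread e X) = tone.
Proof.
apply: tmap_spread_one => //.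
by have := loc_unit loc [set: gT]%G; rewrite spread_to_top spread_top.
Qed.

Lemma loc_surj_all X (b : B X) : exists a, eta _ a = b.
Proof.
elim/gset_ind: X b => [X X0 b|K X Y i1 i2 iB IH b].
  by exists tzero; apply: tval_empty.
have [a1 [k ak]] := loc_surj loc (tres i1 b); have [a2 a2b] := IH (tres i2 b).
have [a ai1 ai2] := decomp_ex iB a1 a2; exists a.
apply: (decomp_ext iB); rewrite -tmap_res ?ai1 ?ai2 // -ak tmap_texp.
by rewrite spread_to_top loc_spread texp_one tmul1.
Qed.

Lemma loc_inj_all X (a a' : A X) : eta _ a = eta _ a' ->
  tmul (spread e X) a = tmul (spread e X) a'.
Proof.
elim/gset_ind: X a a' => [X X0 a a' _|K X Y i1 i2 iB IH a a' aa].
  exact: tval_empty.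
have aai Z (i : hmap Z X) : eta _ (tres i a) = eta _ (tres i a').
  by rewrite !tmap_res aa.
apply: (decomp_ext iB); rewrite !tres_mul !tres_spread; last exact: IH.
have [k] := loc_inj loc (aai _ i1); rewrite spread_to_top.
move/(congr1 (tmul (spread e (orb K)))).
by rewrite !tmulA texp_idem ?spread_idem.
Qed.

(** Since [e] becomes [1] in both targets, the localization is surjective, with
    kernel contained in that of any other map inverting [e]. *)
Lemma loc_initial : is_initial_inverting eta e.
Proof.
split.
  have := loc_unit loc [set: gT]%G.
  by rewrite spread_to_top spread_top.
move=> R psi psi_e.
have psi1 X : psi X (spread e X) = tone by exact: tmap_spread_one.
have psiE X (a a' : A X) : eta _ a = eta _ a' -> psi _ a = psi _ a'.
  move/loc_inj_all/(congr1 (psi X)).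
  by rewrite !tmap_mul psi1 !(tmulC tone) !tmul1.
pose lift X (b : B X) := sval (constructive_indefinite_description _ (loc_surj_all b)).
have liftK X (b : B X) : eta _ (lift X b) = b.
  by rewrite /lift; case: constructive_indefinite_description.
have thetaE X (a : A X) : psi _ (lift X (eta _ a)) = psi _ a by apply/psiE/liftK.
have thetaP X Y (w : bispan X Y) (hw : badm I w) (b : B X) :
    psi _ (lift Y (tmor hw b)) = tmor hw (psi _ (lift X b)).
  by rewrite -{1}(liftK X b) -tmapP thetaE tmapP.
exists (@TMap _ _ B R (fun X b => psi _ (lift X b)) thetaP); split=> [X a|t tE X b] /=.
  exact: thetaE.
by rewrite -{1}(liftK X b) tE.
Qed.
End Universal.

(** * Admissibility and the norm of the idempotent *)

Section Main.
Variables (gT : finGroupType) (P : nat_pred) (A : tambara gT).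
Hypothesis hA : local_burnside P A.
Variable phi : {group gT} -> A (orb [set: gT]%G) -> rat.
Hypothesis hphi : forall Q : {group gT}, is_mark P Q (phi Q).
Variable L : {group gT}.
Hypothesis hL : solv_res P L = L.
Variable e : A (orb [set: gT]%G).
Hypothesis ee : tmul e e = e.
Hypothesis heL : forall Q : {group gT},
  phi Q e = ([exists g : gT, (solv_res P Q == L :^ g :> {set gT})%g]%:R)%R.
Implicit Types (X Y Z S : gset gT) (K Q H : {group gT}).
Local Notation mark_at := (mark_at phi).
Local Notation IL := (Indexing (admissible_axioms L)).

Lemma conj_perfect g : solv_res P (L :^ g)%G = (L :^ g)%G.
Proof. by rewrite solv_resJ hL. Qed.

Lemma phi_one Q g : solv_res P Q = (L :^ g)%G -> phi Q e = 1%R.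
Proof.
move=> QL; rewrite heL; suff -> : [exists g, solv_res P Q == L :^ g :> {set gT}] by [].
by apply/existsP; exists g; rewrite QL.
Qed.

Lemma admissible_quo H K : K \subset H -> admissible L (hquo H K) -> star L H K.
Proof.
move=> sKH adm x sLH; have := adm (quo_pt K (group1 H)) x sLH.
move/subset_trans; apply; apply/subsetP=> k; rewrite capP => /andP[kH].
by rewrite quo_ptM quo_pt_eq invg1 mulg1 mul1g.
Qed.

(** For [Q] with residual [L'] conjugate to [L], admissibility forces [L'] into
    every stabilizer in the fibre, so that all factors of the mark are [1]. *)
Lemma nrm_spread_adm X Y (f : hmap X Y) : badm IL (Nb f) ->
  tmul (spread e Y) (nrm f (spread e X)) = spread e Y.
Proof.
move=> hf; apply: (mark_inj hA hphi) => Q y.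
case: (boolP (Q \subset stab y)) => Qy; last by rewrite !mark_at_out.
rewrite (mark_at_mul hA hphi) (mark_at_bang hA hphi) // heL.
case: existsP => [[g /eqP QL]|_]; last by rewrite GRing.mul0r.
rewrite GRing.mul1r (mark_nrm_one hA hphi) // => x fx.
have QLg : solv_res P Q = (L :^ g)%G by apply/group_inj.
have sLQ : L :^ g \subset Q by rewrite -QL solv_res_sub.
have sLx : L :^ g \subset stab x.
  apply: (admissible_quo (stab_map f x) (hf x)).
  by rewrite fx; apply: subset_trans sLQ Qy.
apply: (@phi_one _ g); rewrite -QLg; apply: solv_res_between.
- by rewrite QLg conj_perfect.
- by rewrite QL subsetI sLQ.
- exact: subsetIl.
Qed.

Lemma part_localization : tambara_under e IL.
Proof.
exists (part_tambara ee nrm_spread_adm), (part_map ee nrm_spread_adm).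
exact: part_map_localization.
Qed.

(** Norms of units are units, so [N e] is inverted as soon as the norm descends;
    a conjugate of [L] outside [K] would give it a vanishing mark_at. *)
Lemma admissible_maximal (J : indexing gT) : tambara_under e J -> ix_le J IL.
Proof.
move=> [B [eta loc]] H S JS x y sLH.
set K : {group gT} := 'C_H[x | hact S]%G.
have JHK : J H (hquo H K) by apply: ix_quo_stab JS.
have sKH : K \subset H by exact: subsetIl.
have sKb : K \subset stab (orb_at H 1) by rewrite stab_base.
pose f := orb_map sKb.
have hf : badm J (Nb f).
  move=> w; have [g ->] := orb_atP w.
  have -> : stab (bnrm (Nb f) (orb_at K g)) = (H :^ g)%G.
    rewrite -(stab_orb_at H g); congr (stab _).
    by rewrite [LHS](orb_mapE sKb g) orb_at_act mul1g.
  rewrite stab_orb_at.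
  apply: (@ix_quo_stab _ J _ _ (hpull (subxx (H :^ g)) (hquo H K)) (quo_pt K (group1 H))).
    apply/setP=> k; rewrite capP [in LHS]mem_conjg [in RHS]mem_conjg.
    case kH: (k ^ g^-1 \in H); last first.
      by apply: contraFF kH; apply: (subsetP sKH).
    rewrite mk_hsetE ?mem_conjg // /hpull_op quo_ptM quo_pt_eq.
    by rewrite invg1 mulg1 mul1g.
  exact: ix_pull (ixP J) _ _ _ _ _ JHK.
have ee' : tmul (e : forget J A _) e = e by rewrite -[RHS]ee; apply: tmor_irr.
have sE X : spread (e : forget J A _) X = spread e X by apply: tmor_irr.
have etaN : eta _ (nrm f (spread e (orb K))) = eta _ (tone : forget J A _).
  transitivity (tnrm hf (eta _ (spread (e : forget J A _) (orb K)))).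
    rewrite sE -tmap_nrm; congr (eta _ _); exact: tmor_irr.
  by rewrite (loc_spread ee' loc) tnrm_one tmap_one.
have := loc_inj_all ee' loc etaN; rewrite tmul1 !sE => eN.
have {}eN : tmul (spread e (orb H)) (nrm f (spread e (orb K))) = spread e (orb H).
  by rewrite -[RHS]eN; apply: tmor_irr.
pose Q := (L :^ y)%G.
have Qb : Q \subset stab (orb_at H 1) by rewrite stab_base.
have phiQ : phi Q e = 1%R by apply: phi_one; apply: conj_perfect.
have := congr1 (mark_at Q (orb_at H 1)) eN.
rewrite (mark_at_mul hA hphi) (mark_at_bang hA hphi) // phiQ GRing.mul1r => N1.
have fb : f (orb_at K 1) = orb_at H 1 by rewrite orb_mapE orb_at_act mulg1.
suff sQK : Q :&: K = Q by rewrite -[L :^ y]/(Q : {set gT}) -sQK subsetIr.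
have : phi (Q :&: stab (orb_at K 1%g))%G e <> 0%R.
  move=> e0; have := mark_nrm_zero hA hphi (f := f) Qb fb e0.
  by rewrite N1 => /eqP; rewrite GRing.oner_eq0.
rewrite stab_base heL; case: existsP => [[g /eqP QL] _|_ []//].
apply/eqP; rewrite eqEcard subsetIl /= cardJg -(cardJg L g) -QL.
exact: subset_leq_card (solv_res_sub _ _).
Qed.
End Main.

Theorem theorem4p20 (gT : finGroupType) (P : nat_pred)
    (hP : forall p : nat, p \in P -> prime p)
    (A : tambara gT) (hA : local_burnside P A)
    (phi : {group gT} -> A (orb [set: gT]%G) -> rat)
    (hphi : forall Q : {group gT}, is_mark P Q (phi Q))
    (L : {group gT}) (hL : solv_res P L = L)
    (e : A (orb [set: gT]%G)) (he : primitive_idempotent e)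
    (heL : forall Q : {group gT},
       phi Q e = ([exists g : gT, (solv_res P Q == L :^ g :> {set gT})%g]%:R)%R) :
  exists hI : indexing_axioms (@admissible gT L),
    let IL : indexing gT := Indexing hI in
    [/\ tambara_under e IL,
        forall J : indexing gT, tambara_under e J -> ix_le IL J -> ix_le J IL
      & forall (B : itambara IL) (eta : tmap (forget IL A) B),
          is_localization eta e -> is_initial_inverting eta e].
Proof.
have [ee _ _] := he; exists (admissible_axioms L) => IL; split.
- exact: (part_localization hA hphi hL ee heL).
- by move=> J eJ _; exact: (admissible_maximal hA hphi hL ee heL eJ).
- move=> B eta; apply: loc_initial.
  by rewrite -[RHS]ee; apply: tmor_irr.
Qed.
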